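(* For every generalized functional $\Phi\in \mathcal{S}^*(Z)$, $$\Phi = \mathfrak{E}\Phi + \sum_{k=0}^{\infty}\mathfrak{a}_k^{\dag}\mathfrak{E}_{k-1}\mathfrak{a}_k\Phi,$$ where $\mathfrak{E}_{-1}=\mathfrak{E}$ and the series on the right-hand side converges in the strong topology of $\mathcal{S}^*(Z)$.
   Context: $\mathbb{N}=\{0,1,2,\dots\}$ and $\Gamma$ is the set of all finite subsets of $\mathbb{N}$; for $\sigma\in\Gamma$, $k\in\mathbb{N}$, write $\sigma\cup k=\sigma\cup\{k\}$, $\sigma\setminus k=\sigma\setminus\{k\}$, and $\mathbf{1}_\sigma$ for the indicator of $\sigma$. $(\Omega,\mathcal{F},P)$ is a probability space with expectation $\mathbb{E}$. A discrete-time normal noise is a sequence $Z=(Z_n)_{n\in\mathbb{N}}$ of integrable (real) random variables on $\Omega$ with $\mathbb{E}[Z_n\mid\mathcal{F}_{n-1}]=0$ and $\mathbb{E}[Z_n^2\mid\mathcal{F}_{n-1}]=1$ for all $n\ge 0$, where $\mathcal{F}_{-1}=\{\emptyset,\Omega\}$ and $\mathcal{F}_n=\sigma(Z_k;0\le k\le n)$. Put $Z_\emptyset=1$ and $Z_\sigma=\prod_{i\in\sigma}Z_i$ for nonempty $\sigma\in\Gamma$; $\{Z_\sigma\mid\sigma\in\Gamma\}$ is an orthonormal system. Let $\mathcal{F}_\infty=\sigma(Z_n;n\in\mathbb{N})$ and let $\mathcal{L}^2(Z)=\mathcal{L}^2(\Omega,\mathcal{F}_\infty,P)$ (complex-valued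 functions), with inner product $\langle\cdot,\cdot\rangle$ conjugate-linear in the first and linear in the second argument. $Z$ is a fixed discrete-time normal noise having the chaotic representation property: $\{Z_\sigma\}$ is total in $\mathcal{L}^2(Z)$, hence an orthonormal basis of it. $\lambda_\emptyset=1$ and $\lambda_\sigma=\prod_{k\in\sigma}(k+1)$ for nonempty $\sigma\in\Gamma$. For real $p\ge0$, $\mathcal{S}_p(Z)=\{\xi\in\mathcal{L}^2(Z)\mid\|\xi\|_p^2:=\sum_{\sigma\in\Gamma}\lambda_\sigma^{2p}|\langle Z_\sigma,\xi\rangle|^2<\infty\}$, a Hilbert space. $\mathcal{S}(Z)=\bigcap_{p\ge0}\mathcal{S}_p(Z)$ has the topology generated by the norms $\|\cdot\|_p$, $p\ge 0$; it contains every $Z_\sigma$. $\mathcal{S}^*(Z)$ is the dual (continuous linear functionals) of $\mathcal{S}(Z)$ with the strong topology; its elements are called generalized functionals of $Z$. For $\Phi\in\mathcal{S}^*(Z)$, its Fock transform is the function $\widehat\Phi(\sigma)=\Phi(Z_\sigma)$, $\sigma\in\Gamma$; $\Phi$ is determined by $\widehat\Phi$. Operators: for $k\ge 0$, $\mathfrak{a}_k$, $\mathfrak{a}_k^{\dag}$, $\mathfrak{E}$, $\mathfrak{E}_k$ are the (continuous linear) operators from $\mathcal{S}^*(Z)$ to itself determined by $\widehat{\mathfrak{a}_k\Phi}(\sigma)=[1-\mathbf{1}_\sigma(k)]\widehat\Phi(\sigma\cup k)$, $\widehat{\mathfrak{a}_k^{\dag}\Phi}(\sigma)=\mathbf{1}_\sigma(k)\widehat\Phi(\sigma\setminus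 k)$, $\widehat{\mathfrak{E}\Phi}(\sigma)=\widehat\Phi(\emptyset)\langle 1,Z_\sigma\rangle$, and $\widehat{\mathfrak{E}_k\Phi}(\sigma)=\mathbf{1}_{\Gamma_{k]}}(\sigma)\widehat\Phi(\sigma)$ for all $\sigma\in\Gamma$, where $\Gamma_{k]}=\{\sigma\in\Gamma\mid\max\sigma\le k\}$, with $\emptyset\in\Gamma_{k]}$. *)

(* Defs.v *)
From HB Require Import structures.
From mathcomp Require Import all_boot all_order all_algebra.
From mathcomp Require Import finmap complex ring lra.
From mathcomp Require Import all_classical all_reals all_analysis.
From mathcomp Require Import measurable_realfun.

Set Implicit Arguments.
Unset Strict Implicit.
Unset Printing Implicit Defensive.
Import Order.TTheory GRing.Theory Num.Theory.
Import numFieldNormedType.Exports.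

Local Open Scope classical_set_scope.
Local Open Scope ring_scope.

Section conditional_expectation.
Context d (T : measurableType d) (R : realType) (P : probability T R).

Definition measurable_wrt (G : set (set T)) (f : T -> R) :=
  forall B, measurable B -> G (f @^-1` B).

(* the sigma-algebra generated by the X k, k in D *)
Definition generated_sigma (X : nat -> T -> R) (D : set nat) : set (set T) :=
  <<s \bigcup_(k in D) preimage_set_system setT (X k) measurable >>.

(* Y is a version of E[X | G], for a sub-sigma-algebra G *)
Definition is_condexp (G : set (set T)) (X Y : T -> R) :=
  [/\ P.-integrable setT (EFin \o X), P.-integrable setT (EFin \o Y),
      measurable_wrt G Y &
      forall A, G A ->
        (\int[P]_(x in A) (X x)%:E = \int[P]_(x in A) (Y x)%:E)%E].

End conditional_expectation.

Section normal_noise.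
Context d (T : measurableType d) (R : realType) (P : probability T R).

(* F_{n-1}; it is generated by the empty family, hence trivial, for n = 0 *)
Definition past (Z : nat -> T -> R) (n : nat) : set (set T) :=
  generated_sigma Z [set k | (k < n)%N].

Record normal_noise := NormalNoise {
  noise :> nat -> T -> R;
  noise_integrable : forall n, P.-integrable setT (EFin \o noise n);
  noise_mean0 : forall n, is_condexp P (past noise n) (noise n) (cst 0);
  noise_var1 : forall n,
    is_condexp P (past noise n) (fun w => noise n w ^+ 2) (cst 1) }.

End normal_noise.

Section L2.
Context d (T : measurableType d) (R : realType) (P : probability T R).
Local Notation C := (R[i]^o).

(* |z| ^ 2, as an element of R *)
Definition normsq (z : C) : R := complex.Re z ^+ 2 + complex.Im z ^+ 2.

Definition cexpectation (f : T -> C) : C :=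
  Complex (\int[P]_w complex.Re (f w)) (\int[P]_w complex.Im (f w)).

Definition inner (f g : T -> C) : C :=
  cexpectation (fun w => (f w)^*%C * g w).

Definition rprod (Z : nat -> T -> R) (s : {fset nat}) (w : T) : R :=
  \prod_(k <- s) Z k w.

(* the functional Z_s, as an element of the complex L^2 *)
Definition zprod (Z : nat -> T -> R) (s : {fset nat}) : T -> C :=
  fun w => (rprod Z s w)%:C%C.

Definition in_L2 (Z : nat -> T -> R) (xi : T -> C) :=
  [/\ measurable_wrt (generated_sigma Z setT) (fun w => complex.Re (xi w)),
      measurable_wrt (generated_sigma Z setT) (fun w => complex.Im (xi w)) &
      (\int[P]_w (normsq (xi w))%:E < +oo)%E].

(* the Z_s are total in L^2(Z): their linear span is dense *)
Definition chaotic_representation (Z : nat -> T -> R) :=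
  forall xi, in_L2 Z xi -> forall e : R, 0 < e ->
  exists (c : {fset nat} -> C) (r : seq {fset nat}),
    (\int[P]_w (normsq (xi w - \sum_(s <- r) c s * zprod Z s w))%:E < e%:E)%E.

Definition weight (s : {fset nat}) : R := \prod_(k <- s) k.+1%:R.

(* the square of the p-norm, possibly infinite *)
Definition snorm2 (Z : nat -> T -> R) (p : R) (xi : T -> C) : \bar R :=
  \esum_(s in [set: {fset nat}])
    (weight s `^ (2 * p) * normsq (inner (zprod Z s) xi))%:E.

Definition in_Sp (Z : nat -> T -> R) (p : R) (xi : T -> C) :=
  in_L2 Z xi /\ (snorm2 Z p xi < +oo)%E.

Definition in_S (Z : nat -> T -> R) (xi : T -> C) :=
  forall p : R, 0 <= p -> in_Sp Z p xi.

End L2.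

Section condexp_theory.
Context d (T : measurableType d) (R : realType) (P : probability T R).
Import HBNNSimple.

Lemma measurable_wrtP (X : set (set T)) (f : T -> R) :
  measurable_wrt <<s X>> f <->
  measurable_fun [set: g_sigma_algebraType X] (f : g_sigma_algebraType X -> R).
Proof.
split=> [mf _ B mB|mf B mB]; first by rewrite setTI; exact: mf.
by rewrite -[_ @^-1` _]setTI; exact: mf.
Qed.

Lemma measurable_wrt_sub (G : set (set T)) (f : T -> R) :
  G `<=` measurable -> measurable_wrt G f -> measurable_fun setT f.
Proof. by move=> sG mf _ B mB; rewrite setTI; apply: sG; exact: mf. Qed.

Lemma ge0_integral_wrt (X : set (set T)) (F F' Y : T -> R) :
  <<s X>> `<=` measurable ->
  measurable_fun setT F -> measurable_fun setT F' ->
  (forall w, 0 <= F w) -> (forall w, 0 <= F' w) ->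
  (forall A, <<s X>> A ->
    \int[P]_(x in A) (F x)%:E = \int[P]_(x in A) (F' x)%:E)%E ->
  measurable_wrt <<s X>> Y -> (forall w, 0 <= Y w) ->
  (\int[P]_w ((Y w)%:E * (F w)%:E) = \int[P]_w ((Y w)%:E * (F' w)%:E))%E.
Proof.
move=> sX mF mF' F0 F'0 FF' /measurable_wrtP mY Y0.
have mEY : measurable_fun [set: g_sigma_algebraType X] (EFin \o Y).
  exact/measurable_EFinP.
pose h := nnsfun_approx measurableT mEY.
have hnd a b w : (a <= b)%N -> h a w <= h b w.
  by move=> ab; have /lefP := nd_nnsfun_approx measurableT mEY ab; exact.
have mh n y : <<s X>> (h n @^-1` [set y]).
  have := @measurable_funPT _ _ _ _ (h n) measurableT [set y] (measurable_set1 _).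
  by rewrite setTI.
have mhT n : measurable_fun [set: T] (h n : T -> R).
  by apply: (measurable_wrt_sub sX); apply/measurable_wrtP; exact: measurable_funPT.
have step (E : T -> R) : measurable_fun setT E -> (forall w, 0 <= E w) ->
  (\int[P]_w ((Y w)%:E * (E w)%:E) = limn (fun n => \sum_(y \in range (h n))
     (y%:E * \int[P]_(x in h n @^-1` [set y]) (E x)%:E)))%E.
  move=> mE E0.
  have -> : (\int[P]_w ((Y w)%:E * (E w)%:E) =
      limn (fun n => \int[P]_w ((h n w)%:E * (E w)%:E)))%E.
    rewrite -monotone_convergence//.
    - apply: eq_integral => w _; apply/esym/cvg_lim => //.
      apply: cvgeZr => //.
      exact: (cvg_nnsfun_approx measurableT mEY (fun x _ => Y0 x) (x := w) I).
    - by move=> n; apply: emeasurable_funM; exact/measurable_EFinP.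
    - by move=> n w _; rewrite mule_ge0// lee_fin.
    - by move=> w _ a b ab; apply: lee_wpmul2r; rewrite lee_fin//; exact: hnd.
  congr (limn _); apply/funext => n.
  have nn y x : (0 <= (y * \1_(h n @^-1` [set y]) x)%:E :> \bar R)%E.
    exact: nnfun_muleindic_ge0.
  transitivity (\int[P]_w (\sum_(y \in range (h n))
    (y * \1_(h n @^-1` [set y]) w)%:E * (E w)%:E))%E.
    apply: eq_integral => x _; rewrite -ge0_mule_fsuml//.
    by rewrite fsumEFin // -(fimfunE (h n) x).
  rewrite ge0_integral_fsum//.
  2: { move=> y; apply: emeasurable_funM; apply/measurable_EFinP => //.
    apply: measurable_funM => //; apply: measurable_indic; exact: sX. }
  2: { by move=> y x _; rewrite mule_ge0 ?lee_fin//; exact: nn. }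
  apply: eq_fsbigr => r rhn.
  have r0 : 0 <= r by move: rhn; rewrite inE => -[t _ <-].
  under eq_integral do rewrite EFinM -muleA.
  rewrite ge0_integralZl//.
  - congr (_ * _)%E; under eq_integral do rewrite muleC.
    transitivity (\int[P]_x ((EFin \o E) \_ (h n @^-1` [set r])) x)%E.
      by apply: eq_integral => x _; rewrite epatch_indic.
    by rewrite -integral_mkcond.
  - apply: emeasurable_funM; apply/measurable_EFinP => //.
    by apply: measurable_indic; exact: sX.
  - by move=> t Et; rewrite mule_ge0 ?lee_fin.
rewrite !step//; congr (limn _); apply/funext => n.
by apply: eq_fsbigr => y _; rewrite FF'.
Qed.
End condexp_theory.

Section integral_wrt.
Context d (T : measurableType d) (R : realType) (P : probability T R).
Implicit Types F Y : T -> R.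

Lemma integral_EFinDB (A : set T) F1 F2 F3 : measurable A ->
  P.-integrable A (EFin \o F1) -> P.-integrable A (EFin \o F2) ->
  P.-integrable A (EFin \o F3) ->
  (\int[P]_(x in A) (F1 x + (F2 x - F3 x))%:E =
   \int[P]_(x in A) (F1 x)%:E +
   (\int[P]_(x in A) (F2 x)%:E - \int[P]_(x in A) (F3 x)%:E))%E.
Proof.
move=> mA i1 i2 i3.
have i23 : P.-integrable A (EFin \o (F2 \- F3)).
  by rewrite (_ : EFin \o _ = ((EFin \o F2) \- (EFin \o F3))%E)//; exact: integrableB.
under eq_integral do rewrite EFinD.
rewrite integralD//; congr (_ + _)%E.
by under eq_integral do rewrite EFinB; rewrite integralB.
Qed.

Let integral_wrt_ge0 (X : set (set T)) F F' Y :
  <<s X>> `<=` measurable ->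
  P.-integrable setT (EFin \o F) -> P.-integrable setT (EFin \o F') ->
  (forall A, <<s X>> A ->
    \int[P]_(x in A) (F x)%:E = \int[P]_(x in A) (F' x)%:E)%E ->
  measurable_wrt <<s X>> Y -> (forall w, 0 <= Y w) ->
  P.-integrable setT (EFin \o (fun w => Y w * F w)) ->
  P.-integrable setT (EFin \o (fun w => Y w * F' w)) ->
  (\int[P]_w (Y w * F w)%:E = \int[P]_w (Y w * F' w)%:E)%E.
Proof.
move=> sX iF iF' FF' mY Y0 iYF iYF'.
pose H w : R := `|F w| + `|F' w|.
pose G w : R := H w + (F w - F' w).
have mF : measurable_fun setT F by apply/measurable_EFinP; exact: measurable_int iF.
have mF' : measurable_fun setT F' by apply/measurable_EFinP; exact: measurable_int iF'.
have mYT := measurable_wrt_sub sX mY.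
have iH : P.-integrable setT (EFin \o H).
  rewrite (_ : EFin \o H = ((EFin \o (Num.norm \o F)) \+ (EFin \o (Num.norm \o F')))%E)//.
  by apply: integrableD => //; exact: integrable_norm.
have iYH : P.-integrable setT (EFin \o (fun w => Y w * H w)).
  rewrite (_ : EFin \o _ = ((EFin \o (Num.norm \o (fun w => Y w * F w)%R)) \+
    (EFin \o (Num.norm \o (fun w => Y w * F' w)%R)))%E); last first.
    by apply/funext => w /=; rewrite !normrM (ger0_norm (Y0 w)) -EFinD mulrDr.
  by apply: integrableD => //; exact: integrable_norm.
have mH : measurable_fun setT H.
  by apply: measurable_funD; exact: measurableT_comp.
have H0 w : 0 <= H w by rewrite addr_ge0.
have G0 w : 0 <= G w.
  rewrite /G /H; have := ler_norm (F' w); have := ler_norm (- F w).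
  by rewrite normrN; lra.
have mG : measurable_fun setT G.
  by apply: measurable_funD => //; exact: measurable_funB.
have fin E : P.-integrable setT (EFin \o E) -> (\int[P]_w (E w)%:E)%E \is a fin_num.
  exact: integrable_fin_num.
have GH A : <<s X>> A ->
    (\int[P]_(x in A) (G x)%:E = \int[P]_(x in A) (H x)%:E)%E.
  move=> XA; have mA := sX _ XA.
  have i E : P.-integrable setT (EFin \o E) -> P.-integrable A (EFin \o E).
    by apply: integrableS.
  rewrite integral_EFinDB//; try exact: i.
  by rewrite FF'// subee ?adde0//; apply: integrable_fin_num => //; exact: i.
have := ge0_integral_wrt sX mG mH G0 H0 GH mY Y0.
have -> : (\int[P]_w ((Y w)%:E * (G w)%:E) = \int[P]_w (Y w * H w)%:E +
    (\int[P]_w (Y w * F w)%:E - \int[P]_w (Y w * F' w)%:E))%E.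
  rewrite -integral_EFinDB//.
  by apply: eq_integral => w _; rewrite -EFinM; congr EFin; rewrite /G; ring.
have -> : (\int[P]_w ((Y w)%:E * (H w)%:E) = \int[P]_w (Y w * H w)%:E)%E.
  by apply: eq_integral => w _; rewrite EFinM.
rewrite -(fineK (fin _ iYH)) -(fineK (fin _ iYF)) -(fineK (fin _ iYF')).
by move=> [] ?; congr EFin; lra.
Qed.

Lemma integral_wrt (X : set (set T)) F F' Y :
  <<s X>> `<=` measurable ->
  P.-integrable setT (EFin \o F) -> P.-integrable setT (EFin \o F') ->
  (forall A, <<s X>> A ->
    \int[P]_(x in A) (F x)%:E = \int[P]_(x in A) (F' x)%:E)%E ->
  measurable_wrt <<s X>> Y ->
  P.-integrable setT (EFin \o (fun w => Y w * F w)) ->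
  P.-integrable setT (EFin \o (fun w => Y w * F' w)) ->
  (\int[P]_w (Y w * F w)%:E = \int[P]_w (Y w * F' w)%:E)%E.
Proof.
move=> sX iF iF' FF' mY iYF iYF'.
have mF : measurable_fun setT F by apply/measurable_EFinP; exact: measurable_int iF.
have mF' : measurable_fun setT F' by apply/measurable_EFinP; exact: measurable_int iF'.
have mYT := measurable_wrt_sub sX mY.
have mN : measurable_wrt <<s X>> (Num.norm \o Y).
  by apply/measurable_wrtP; apply: measurableT_comp => //; exact/measurable_wrtP.
have mNY : measurable_wrt <<s X>> (fun w => `|Y w| + Y w).
  by apply/measurable_wrtP; apply: measurable_funD; exact/measurable_wrtP.
have iN E : measurable_fun setT E -> P.-integrable setT (EFin \o (fun w => Y w * E w)) ->
    P.-integrable setT (EFin \o (fun w => `|Y w| * E w)).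
  move=> mE; apply: le_integrable => //.
    apply/measurable_EFinP; apply: measurable_funM => //; exact: measurableT_comp.
  by move=> w _ /=; rewrite lee_fin !normrM normr_id.
have iNY E : measurable_fun setT E -> P.-integrable setT (EFin \o (fun w => Y w * E w)) ->
    P.-integrable setT (EFin \o (fun w => (`|Y w| + Y w) * E w)).
  move=> mE iE; rewrite (_ : EFin \o _ = ((EFin \o (fun w => `|Y w| * E w)%R) \+
    (EFin \o (fun w => Y w * E w)%R))%E); last first.
    by apply/funext => w /=; rewrite -EFinD mulrDl.
  by apply: integrableD => //; exact: iN.
have := integral_wrt_ge0 sX iF iF' FF' mN (fun w => normr_ge0 _)
  (iN _ mF iYF) (iN _ mF' iYF').
have NY0 w : 0 <= `|Y w| + Y w.
  by have := ler_norm (- Y w); rewrite normrN; lra.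
have := integral_wrt_ge0 sX iF iF' FF' mNY NY0 (iNY _ mF iYF) (iNY _ mF' iYF').
have E E' : measurable_fun setT E' ->
    P.-integrable setT (EFin \o (fun w => Y w * E' w)) ->
    (\int[P]_w ((`|Y w| + Y w) * E' w)%:E = \int[P]_w (`|Y w| * E' w)%:E +
     \int[P]_w (Y w * E' w)%:E)%E.
  move=> mE iE; under eq_integral do rewrite mulrDl EFinD.
  by rewrite integralD//; exact: iN.
rewrite !E// => + e; rewrite /= -e.
have fin G : P.-integrable setT (EFin \o G) -> (\int[P]_w (G w)%:E)%E \is a fin_num.
  exact: integrable_fin_num.
rewrite -(fineK (fin _ iYF)) -(fineK (fin _ iYF')) -(fineK (fin _ (iN _ mF iYF))).
by move=> [] ?; congr EFin; lra.
Qed.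
End integral_wrt.

Section orthonormality.
Context d (T : measurableType d) (R : realType) (P : probability T R).

Lemma integrable_mul (a b : T -> R) :
  measurable_fun setT a -> measurable_fun setT b ->
  (\int[P]_w (a w ^+ 2)%:E < +oo)%E -> (\int[P]_w (b w ^+ 2)%:E < +oo)%E ->
  P.-integrable setT (EFin \o (fun w => a w * b w)).
Proof.
move=> ma mb a2 b2.
have i2 (c : T -> R) : measurable_fun setT c -> (\int[P]_w (c w ^+ 2)%:E < +oo)%E ->
    P.-integrable setT (EFin \o (fun w => c w ^+ 2)).
  move=> mc c2; apply/integrableP; split.
    by apply/measurable_EFinP; exact: measurable_funX.
  by under eq_integral do rewrite /= ger0_norm ?sqr_ge0//.
have i : P.-integrable setT (EFin \o (fun w => a w ^+ 2 + b w ^+ 2)).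
  rewrite (_ : EFin \o _ = ((EFin \o (fun w => a w ^+ 2)%R) \+
    (EFin \o (fun w => b w ^+ 2)%R))%E)//.
  by apply: integrableD => //; exact: i2.
apply: le_integrable i => //.
  by apply/measurable_EFinP; exact: measurable_funM.
move=> w _ /=; rewrite lee_fin [leRHS]ger0_norm ?addr_ge0 ?sqr_ge0//.
rewrite ler_norml; apply/andP; split.
  have := sqr_ge0 (a w + b w); have := sqr_ge0 (a w); have := sqr_ge0 (b w).
  by rewrite sqrrD; lra.
have := sqr_ge0 (a w - b w); have := sqr_ge0 (a w); have := sqr_ge0 (b w).
by rewrite sqrrB; lra.
Qed.

Variable Z : normal_noise P.

Lemma measurable_noise n : measurable_fun setT (Z n).
Proof. apply/measurable_EFinP; exact: measurable_int (noise_integrable Z n). Qed.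

Lemma generated_sigma_sub D : generated_sigma Z D `<=` measurable.
Proof.
apply: smallest_sub; first exact: sigma_algebra_measurable.
move=> _ [k _ [B mB <-]]; exact: measurable_noise.
Qed.

Local Notation rprod := (rprod Z).

Lemma measurable_rprod D (s : {fset nat}) : (forall k, k \in s -> D k) ->
  measurable_wrt (generated_sigma Z D) (rprod s).
Proof.
move=> sD; apply/measurable_wrtP.
have mZ k : k \in s -> measurable_fun
    [set: g_sigma_algebraType (\bigcup_(k in D) preimage_set_system setT (Z k) measurable)]
    (Z k : _ -> R).
  move=> ks; apply/measurable_wrtP => B mB; apply: sub_gen_smallest.
  by exists k; [exact: sD|exists B => //; rewrite setTI].
exact: measurable_prod.
Qed.

Lemma measurable_rprodT s : measurable_fun setT (rprod s).
Proof.
apply: (measurable_wrt_sub (@generated_sigma_sub setT)).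
exact: measurable_rprod.
Qed.

Lemma rprodD1 s n w : n \in s -> rprod s w = Z n w * rprod (s `\ n)%fset w.
Proof. by move=> ns; rewrite /rprod (big_fsetD1 n). Qed.

Let ltD1 (s : {fset nat}) n : (forall k, k \in s -> (k < n.+1)%N) ->
  forall k, k \in (s `\ n)%fset -> (k < n)%N.
Proof.
move=> sn k; rewrite in_fsetD1 => /andP[kn ks].
by have := sn _ ks; rewrite ltnS leq_eqVlt (negbTE kn).
Qed.

Let ltN (s : {fset nat}) n : (forall k, k \in s -> (k < n.+1)%N) -> n \notin s ->
  forall k, k \in s -> (k < n)%N.
Proof.
move=> sn ns k ks; have := sn _ ks; rewrite ltnS leq_eqVlt => /orP[/eqP kn|//].
by rewrite -kn ks in ns.
Qed.

Lemma integral_rprod2 s : (\int[P]_w (rprod s w ^+ 2)%:E = 1)%E.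
Proof.
have [n sn] : exists n, forall k, k \in s -> (k < n)%N.
  exists (\max_(k <- s) k).+1 => k ks; rewrite ltnS.
  exact: (@leq_bigmax_seq _ _ xpredT id).
elim: n s sn => [|n ih] s sn.
  have -> : s = fset0 by apply/fsetP => k; rewrite inE; apply/negbTE/negP => /sn.
  rewrite (eq_integral (cst 1%E)).
    by rewrite integral_cst// mul1e; exact: probability_setT.
  by move=> w _; rewrite /rprod big_nil expr1n.
have [ns|ns] := boolP (n \in s); last by apply: ih => k; exact: (ltN sn ns).
rewrite -(ih (s `\ n)%fset (ltD1 sn)).
have [_ _ _ cond] := noise_var1 Z n.
have mY := @measurable_rprod [set k | (k < n)%N] _ (ltD1 sn).
have mY2 : measurable_wrt (past Z n) (fun w => rprod (s `\ n)%fset w ^+ 2).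
  by apply/measurable_wrtP; apply: measurable_funX; exact/measurable_wrtP.
have mZ2 : measurable_fun setT (fun w => Z n w ^+ 2).
  by apply: measurable_funX; exact: measurable_noise.
have m1 : measurable_fun [set: T] (cst 1 : T -> R) by exact: measurable_cst.
have := ge0_integral_wrt (@generated_sigma_sub _) mZ2 m1
  (fun w => sqr_ge0 _) (fun w => ler01) cond mY2 (fun w => sqr_ge0 _).
under eq_integral do rewrite -EFinM.
under [in X in _ = X -> _]eq_integral do rewrite mule1.
move=> <-; apply: eq_integral => w _; congr EFin.
by rewrite (rprodD1 _ ns) exprMn mulrC.
Qed.

Lemma integrable_rprodM s t :
  P.-integrable setT (EFin \o (fun w => rprod s w * rprod t w)).
Proof.
by apply: integrable_mul; rewrite ?integral_rprod2 ?ltry//; exact: measurable_rprodT.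
Qed.

Lemma integral_rprodM s t :
  (\int[P]_w (rprod s w * rprod t w)%:E = (s == t)%:R%:E)%E.
Proof.
have [->|st] := eqVneq s t.
  by rewrite -(integral_rprod2 t); apply: eq_integral => w _; rewrite expr2.
have [n sn tn] : exists2 n, (forall k, k \in s -> (k < n)%N) &
    (forall k, k \in t -> (k < n)%N).
  exists (\max_(k <- (s `|` t)%fset) k).+1 => k ks; rewrite ltnS;
  by apply: (@leq_bigmax_seq _ _ xpredT id) => //; rewrite in_fsetU ks ?orbT.
elim: n s t st sn tn => [|n ih] s t st sn tn.
  have s0 : s = fset0 by apply/fsetP => k; rewrite inE; apply/negbTE/negP => /sn.
  have t0 : t = fset0 by apply/fsetP => k; rewrite inE; apply/negbTE/negP => /tn.
  by rewrite s0 t0 eqxx in st.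
have one (u v : {fset nat}) : (forall k, k \in u -> (k < n.+1)%N) ->
    (forall k, k \in v -> (k < n.+1)%N) -> n \in u -> n \notin v ->
    (\int[P]_w (rprod u w * rprod v w)%:E = 0)%E.
  move=> un vn nu nv.
  have [iZ i0 _ cond] := noise_mean0 Z n.
  have mY : measurable_wrt (past Z n) (fun w => rprod (u `\ n)%fset w * rprod v w).
    apply/measurable_wrtP; apply: measurable_funM; apply/measurable_wrtP.
      exact: (@measurable_rprod [set k | (k < n)%N] _ (ltD1 un)).
    exact: (@measurable_rprod [set k | (k < n)%N] _ (ltN vn nv)).
  have E w : rprod u w * rprod v w = rprod (u `\ n)%fset w * rprod v w * Z n w.
    by rewrite (rprodD1 _ nu); ring.
  under eq_integral do rewrite E.
  rewrite (integral_wrt (@generated_sigma_sub _) iZ i0 cond mY).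
  - by under eq_integral do rewrite mulr0; rewrite integral0.
  - by rewrite -(funext E); exact: integrable_rprodM.
  - rewrite (_ : EFin \o _ = cst 0%E); first exact: integrable0.
    by apply/funext => w /=; rewrite mulr0.
have [ns|ns] := boolP (n \in s); have [nt|nt] := boolP (n \in t).
- have [iZ i1 _ cond] := noise_var1 Z n.
  have st' : (s `\ n != t `\ n)%fset.
    by apply: contra st => /eqP e; rewrite -(fsetD1K ns) e fsetD1K.
  rewrite -(ih _ _ st' (ltD1 sn) (ltD1 tn)).
  have mY : measurable_wrt (past Z n)
      (fun w => rprod (s `\ n)%fset w * rprod (t `\ n)%fset w).
    apply/measurable_wrtP; apply: measurable_funM; apply/measurable_wrtP.
      exact: (@measurable_rprod [set k | (k < n)%N] _ (ltD1 sn)).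
    exact: (@measurable_rprod [set k | (k < n)%N] _ (ltD1 tn)).
  have E w : rprod s w * rprod t w =
      rprod (s `\ n)%fset w * rprod (t `\ n)%fset w * Z n w ^+ 2.
    by rewrite (rprodD1 _ ns) (rprodD1 _ nt); ring.
  under eq_integral do rewrite E.
  rewrite (integral_wrt (@generated_sigma_sub _) iZ i1 cond mY).
  - by under eq_integral do rewrite mulr1.
  - by rewrite -(funext E); exact: integrable_rprodM.
  - by rewrite (funext (fun w => mulr1 _)); exact: integrable_rprodM.
- exact: one.
- by under eq_integral do rewrite mulrC; exact: one.
- by apply: ih => //; [move=> k; exact: (ltN sn ns)|exact: (ltN tn nt)].
Qed.

End orthonormality.

Section test_space_closure.
Context d (T : measurableType d) (R : realType) (P : probability T R).
Local Notation C := (R[i]^o).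

Lemma normsq_ge0 (z : C) : 0 <= normsq z.
Proof. by rewrite addr_ge0 ?sqr_ge0. Qed.

Lemma normsq_lin (a x y : C) :
  normsq (a *: x + y) <= 2 * normsq a * normsq x + 2 * normsq y.
Proof.
case: a x y => [a b] [x x'] [y y']; rewrite /normsq /=.
rewrite -subr_ge0 (_ : _ - _ = (a * x - b * x' - y) ^+ 2 + (a * x' + b * x - y') ^+ 2).
  by rewrite addr_ge0 ?sqr_ge0.
by ring.
Qed.

Let scale_addE (a : C) (x y u v : R) :
  a *: (Complex x y : C) + (Complex u v : C) =
  Complex (complex.Re a * x + - complex.Im a * y + u)
          (complex.Re a * y + complex.Im a * x + v).
Proof. by case: a => a b; rewrite mulNr. Qed.

Variable Z : normal_noise P.

Lemma in_L2_ReIm (f : T -> C) : in_L2 P Z f ->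
  [/\ measurable_fun setT (fun w => complex.Re (f w)),
      measurable_fun setT (fun w => complex.Im (f w)),
      (\int[P]_w (complex.Re (f w) ^+ 2)%:E < +oo)%E &
      (\int[P]_w (complex.Im (f w) ^+ 2)%:E < +oo)%E].
Proof.
move=> [mr mi fi].
have mr' := measurable_wrt_sub (@generated_sigma_sub _ _ _ _ Z _) mr.
have mi' := measurable_wrt_sub (@generated_sigma_sub _ _ _ _ Z _) mi.
have mN : measurable_fun setT (fun w => (normsq (f w))%:E).
  by apply/measurable_EFinP; apply: measurable_funD; exact: measurable_funX.
split=> //; apply: le_lt_trans fi; apply: ge0_le_integral => //.
- by move=> w _; rewrite lee_fin sqr_ge0.
- by apply/measurable_EFinP; exact: measurable_funX.
- by move=> w _; rewrite lee_fin lerDl sqr_ge0.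
- by move=> w _; rewrite lee_fin sqr_ge0.
- by apply/measurable_EFinP; exact: measurable_funX.
- by move=> w _; rewrite lee_fin lerDr sqr_ge0.
Qed.

Lemma inner_zprodE s (f : T -> C) : inner P (zprod Z s) f =
  Complex (\int[P]_w (rprod Z s w * complex.Re (f w)))
          (\int[P]_w (rprod Z s w * complex.Im (f w))).
Proof.
rewrite /inner /cexpectation; congr Complex; apply: eq_Rintegral => w _;
by rewrite /zprod; case: (f w) => x y /=; ring.
Qed.

Lemma inner_lin s (a : C) (f g : T -> C) : in_L2 P Z f -> in_L2 P Z g ->
  inner P (zprod Z s) (a *: f + g) =
  a *: inner P (zprod Z s) f + inner P (zprod Z s) g.
Proof.
move=> /in_L2_ReIm[mrf mif rf jf] /in_L2_ReIm[mrg mig rg jg].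
rewrite !inner_zprodE.
have i (h : T -> R) : measurable_fun setT h -> (\int[P]_w (h w ^+ 2)%:E < +oo)%E ->
    P.-integrable setT (EFin \o (fun w => rprod Z s w * h w)).
  move=> mh hoo; apply: integrable_mul => //; first exact: measurable_rprodT.
  by rewrite integral_rprod2 ltry.
have E (c1 c2 : R) (h1 h2 h3 : T -> R) :
    P.-integrable setT (EFin \o (fun w => rprod Z s w * h1 w)) ->
    P.-integrable setT (EFin \o (fun w => rprod Z s w * h2 w)) ->
    P.-integrable setT (EFin \o (fun w => rprod Z s w * h3 w)) ->
    \int[P]_w (rprod Z s w * (c1 * h1 w + c2 * h2 w + h3 w)) =
    c1 * \int[P]_w (rprod Z s w * h1 w) + c2 * \int[P]_w (rprod Z s w * h2 w) +
    \int[P]_w (rprod Z s w * h3 w).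
  move=> i1 i2 i3.
  have iZ c (h : T -> R) : P.-integrable setT (EFin \o h) ->
    P.-integrable setT (EFin \o (fun w => c * h w)) by exact: integrableZl.
  have j1 := iZ c1 _ i1; have j2 := iZ c2 _ i2.
  have j12 : P.-integrable setT (EFin \o (fun w =>
      c1 * (rprod Z s w * h1 w) + c2 * (rprod Z s w * h2 w))).
    rewrite (_ : EFin \o _ = ((EFin \o (fun w => c1 * (rprod Z s w * h1 w))%R) \+
      (EFin \o (fun w => c2 * (rprod Z s w * h2 w))%R))%E)//.
    exact: integrableD.
  rewrite -RintegralZl// -RintegralZl// -RintegralD// -RintegralD//.
  by apply: eq_Rintegral => w _; ring.
rewrite [RHS]scale_addE -!E; try exact: i.
congr Complex; apply: eq_Rintegral => w _; congr (_ * _);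
by rewrite -[(a *: f + g) w]/(a *: f w + g w);
  case: (f w) (g w) => [x y] [u v]; rewrite scale_addE.
Qed.

Lemma in_L2_lin (a : C) (f g : T -> C) :
  in_L2 P Z f -> in_L2 P Z g -> in_L2 P Z (a *: f + g).
Proof.
move=> Lf Lg; have [mrf mif _ _] := in_L2_ReIm Lf.
have [mrg mig _ _] := in_L2_ReIm Lg.
move: Lf Lg => [wrf wif foo] [wrg wig goo].
have wr : measurable_wrt (generated_sigma Z setT)
    (fun w => complex.Re ((a *: f + g) w)).
  rewrite (_ : (fun w => _) = (fun w => complex.Re a * complex.Re (f w)
    - complex.Im a * complex.Im (f w) + complex.Re (g w))); last first.
    apply/funext => w; rewrite -[(a *: f + g) w]/(a *: f w + g w).
    by case: (f w) (g w) => [x y] [u v]; rewrite scale_addE /= ?mulNr.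
  apply/measurable_wrtP; apply: measurable_funD; last exact/measurable_wrtP.
  by apply: measurable_funB; apply: measurable_funM => //; exact/measurable_wrtP.
have wi : measurable_wrt (generated_sigma Z setT)
    (fun w => complex.Im ((a *: f + g) w)).
  rewrite (_ : (fun w => _) = (fun w => complex.Re a * complex.Im (f w)
    + complex.Im a * complex.Re (f w) + complex.Im (g w))); last first.
    apply/funext => w; rewrite -[(a *: f + g) w]/(a *: f w + g w).
    by case: (f w) (g w) => [x y] [u v]; rewrite scale_addE /= ?mulNr.
  apply/measurable_wrtP; apply: measurable_funD; last exact/measurable_wrtP.
  by apply: measurable_funD; apply: measurable_funM => //; exact/measurable_wrtP.
split=> //.
have mN (h : T -> C) : measurable_fun setT (fun w => complex.Re (h w)) ->
    measurable_fun setT (fun w => complex.Im (h w)) ->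
    measurable_fun setT (fun w => (normsq (h w))%:E).
    by move=> *; apply/measurable_EFinP; apply: measurable_funD; exact: measurable_funX.
  have mNf := mN f mrf mif; have mNg := mN g mrg mig.
  apply: (@le_lt_trans _ _ (\int[P]_w ((2 * normsq a)%:E * (normsq (f w))%:E +
      2%:E * (normsq (g w))%:E))%E).
    apply: ge0_le_integral => //.
    + by move=> w _; rewrite lee_fin normsq_ge0.
    + apply: mN.
        exact: measurable_wrt_sub (@generated_sigma_sub _ _ _ _ Z _) wr.
      exact: measurable_wrt_sub (@generated_sigma_sub _ _ _ _ Z _) wi.
    + by apply: emeasurable_funD; exact: emeasurable_funM.
    + by move=> w _; rewrite -!EFinM -EFinD lee_fin normsq_lin.
  have a0 : 0 <= 2 * normsq a by rewrite mulr_ge0 ?normsq_ge0.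
  rewrite ge0_integralD//.
  + rewrite !ge0_integralZl//; try by move=> w _; rewrite lee_fin normsq_ge0.
    by rewrite lte_add_pinfty// lte_mul_pinfty.
  + by move=> w _; rewrite mule_ge0// lee_fin ?normsq_ge0.
  + exact: emeasurable_funM.
  + by move=> w _; rewrite mule_ge0// lee_fin ?normsq_ge0.
  + exact: emeasurable_funM.
Qed.

Lemma in_L2_zprod s : in_L2 P Z (zprod Z s).
Proof.
split.
- exact: measurable_rprod.
- by apply/measurable_wrtP; exact: measurable_cst.
- rewrite (_ : (fun w => _) = (fun w => (rprod Z s w ^+ 2)%:E)).
    by rewrite integral_rprod2 ltry.
  by apply/funext => w; rewrite /normsq /= expr0n addr0.
Qed.

Lemma inner_zprod s t : inner P (zprod Z s) (zprod Z t) = (s == t)%:R.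
Proof.
rewrite inner_zprodE /= /Rintegral integral_rprodM /=.
rewrite (_ : (fun w => _) = cst 0%E) ?integral0.
  by case: (s == t).
by apply/funext => w; rewrite mulr0.
Qed.

End test_space_closure.

Section test_functionals.
Context d (T : measurableType d) (R : realType) (P : probability T R).
Variable Z : normal_noise P.
Local Notation C := (R[i]^o).

Lemma snorm2_lin p (a : C) (f g : T -> C) : in_Sp P Z p f -> in_Sp P Z p g ->
  in_Sp P Z p (a *: f + g).
Proof.
move=> [Lf nf] [Lg ng]; split; first exact: in_L2_lin.
have w0 s : 0 <= weight R s `^ (2 * p) by exact: powR_ge0.
pose t h s : \bar R := (weight R s `^ (2 * p) * normsq (inner P (zprod Z s) h))%:E.
have t0 h s : (0 <= t h s)%E by rewrite lee_fin mulr_ge0 ?normsq_ge0.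
have Zoo (c : R) h : 0 <= c -> (\esum_(s in [set: {fset nat}]) t h s < +oo)%E ->
    (\esum_(s in [set: {fset nat}]) (c%:E * t h s) < +oo)%E.
  move=> c0 hoo.
  apply: (@le_lt_trans _ _ (c%:E * \esum_(s in [set: {fset nat}]) t h s)%E).
    apply: ge_ereal_sup => _ [A [fA _] <-].
    rewrite -ge0_mule_fsumr//; apply: lee_wpmul2l; first by rewrite lee_fin.
    by apply: esum_ge; exists A.
  by rewrite lte_mul_pinfty// ?lee_fin.
have a0 : 0 <= 2 * normsq a by rewrite mulr_ge0 ?normsq_ge0.
apply: (@le_lt_trans _ _ (\esum_(s in [set: {fset nat}])
    ((2 * normsq a)%:E * t f s + 2%:E * t g s))%E).
  apply: le_esum => s _; rewrite /t -!EFinM -EFinD lee_fin inner_lin//.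
  have := ler_wpM2l (w0 s)
    (normsq_lin a (inner P (zprod Z s) f) (inner P (zprod Z s) g)).
  by move=> /le_trans; apply; rewrite le_eqVlt; apply/orP; left; apply/eqP; ring.
rewrite esumD; last 2 first.
- by move=> s _; rewrite mule_ge0// lee_fin.
- by move=> s _; rewrite mule_ge0// lee_fin.
by rewrite lte_add_pinfty//; exact: Zoo.
Qed.

Lemma in_S0 : in_S P Z (0 : T -> C).
Proof.
have i0 s : \int[P]_w (rprod Z s w * 0) = 0.
  rewrite /Rintegral (_ : (fun w => _) = cst 0%E) ?integral0//.
  by apply/funext => w; rewrite mulr0.
move=> p p0; split.
  split; [apply/measurable_wrtP; exact: measurable_cst..|].
  rewrite (_ : (fun w => _) = cst 0%E) ?integral0 ?ltry//.
  by apply/funext => w; rewrite /normsq /= !expr0n addr0.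
rewrite /snorm2 esum1 ?ltry// => s _.
by rewrite inner_zprodE /= i0 /normsq /= !expr0n addr0 mulr0.
Qed.

Definition test_pred : {pred (T -> C)} := mem [set xi | in_S P Z xi].

Lemma test_submod_closed : submod_closed test_pred.
Proof.
split; first by apply/mem_set; exact: in_S0.
move=> a f g /set_mem Sf /set_mem Sg; apply/mem_set => p p0.
by apply: snorm2_lin; [exact: Sf|exact: Sg].
Qed.

HB.instance Definition _ :=
  GRing.isSubmodClosed.Build _ _ test_pred test_submod_closed.

(* S(Z), with genuine functions as elements instead of classes modulo
   almost-everywhere equality. The norms do not see null sets, so the continuous
   linear functionals and the bounded sets are those of the quotient. *)
Record test_functional := TestFunctional {
  test_val :> T -> C;
  test_valP : test_val \in test_pred }.

HB.instance Definition _ := [isSub for test_val].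
HB.instance Definition _ := [Choice of test_functional by <:].
HB.instance Definition _ := [SubChoice_isSubLmodule of test_functional by <:].

Definition snorm (p : R) (xi : test_functional) : R :=
  Num.sqrt (fine (snorm2 P Z p xi)).

Definition snorm_ball (p : R) (xi : test_functional) (e : R) :
  set test_functional := [set eta | snorm p (eta - xi) < e].

(* the topology generated by the norms: the balls form a subbase *)
HB.instance Definition _ := isSubBaseTopological.Build test_functional
  [set B | exists p xi e, [/\ 0 <= p, 0 < e & B = snorm_ball p xi e]] id.

Definition generalized_pred : {pred (test_functional -> C)} :=
  mem [set Phi : test_functional -> C | linear Phi /\ continuous Phi].

Lemma generalized_submod_closed : submod_closed generalized_pred.
Proof.
split; first apply/mem_set; first split.
- by move=> a x y; rewrite scaler0 addr0.
- move=> x; change ((fun _ : test_functional => (0 : C)) @ x --> (0 : C)).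
  by have FF := nbhs_filter x; exact: (@cvg_cst C).
move=> a f g /set_mem[lf cf] /set_mem[lg cg]; apply/mem_set; split.
- move=> b x y.
  rewrite -[LHS]/(a *: f (b *: x + y) + g (b *: x + y)) lf lg.
  rewrite -[(a *: f + g) x]/(a *: f x + g x) -[(a *: f + g) y]/(a *: f y + g y).
  by rewrite !scalerDr !scalerA mulrC addrACA.
- move=> x; change ((fun y => a *: f y + g y) @ x --> a *: f x + g x).
  have FF := nbhs_filter x; apply: cvgD; last exact: cg.
  by apply: cvgZr; exact: cf.
Qed.

HB.instance Definition _ :=
  GRing.isSubmodClosed.Build _ _ generalized_pred generalized_submod_closed.

Record generalized_functional := GeneralizedFunctional {
  generalized_val :> test_functional -> C;
  generalized_valP : generalized_val \in generalized_pred }.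

HB.instance Definition _ := [isSub for generalized_val].
HB.instance Definition _ := [Choice of generalized_functional by <:].
HB.instance Definition _ :=
  [SubChoice_isSubLmodule of generalized_functional by <:].

(* B is absorbed by every neighbourhood of 0 *)
Definition von_neumann_bounded (B : set test_functional) :=
  forall V, nbhs (0 : test_functional) V -> exists2 r : R, 0 < r &
    forall t : R[i], (r%:C)%C <= `|t| -> B `<=` [set t *: v | v in V].

HB.instance Definition _ := isPointed.Build generalized_functional 0.
(* the strong topology: uniform convergence on the bounded subsets of S(Z) *)
HB.instance Definition _ := Topological.copy generalized_functional
  (initial_topology (fun Phi : generalized_functional =>
    (generalized_val Phi : {family von_neumann_bounded, test_functional -> C}))).

End test_functionals.

Section operators.
Context d (T : measurableType d) (R : realType) (P : probability T R).
Variable Z : normal_noise P.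
Local Notation C := (R[i]^o).
Implicit Types (s : {fset nat}) (Phi : generalized_functional Z).

Lemma in_S_zprod s : zprod Z s \in test_pred Z.
Proof.
rewrite inE => p p0; split; first exact: in_L2_zprod.
rewrite /snorm2 (esumID [set s])//; last first.
  by move=> t _; rewrite lee_fin mulr_ge0 ?powR_ge0 ?normsq_ge0.
rewrite !setTI esum_set1 ?lee_fin ?mulr_ge0 ?powR_ge0 ?normsq_ge0//.
rewrite esum1 ?adde0 ?ltry// => t /eqP/negbTE ts.
by rewrite inner_zprod ts /normsq /= !expr0n addr0 mulr0.
Qed.

Definition test_zprod s : test_functional Z := TestFunctional (in_S_zprod s).

Definition fock Phi s : C := Phi (test_zprod s).

(* The generalized functional with Fock transform F; it is unique, and exists
   iff |F s| <= c * weight s ^ p for some c and p. Every F used below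
   satisfies such a bound. *)
Definition of_fock (F : {fset nat} -> C) : generalized_functional Z :=
  xget 0 [set Phi | forall s, fock Phi s = F s].

Definition annihilation k Phi :=
  of_fock (fun s => (1 - (k \in s)%:R) * fock Phi (k |` s)%fset).

Definition creation k Phi :=
  of_fock (fun s => (k \in s)%:R * fock Phi (s `\ k)%fset).

Definition expect Phi :=
  of_fock (fun s => fock Phi fset0 * inner P (cst 1) (zprod Z s)).

Definition cond_expect k Phi :=
  of_fock (fun s => (all (fun j => (j <= k)%N) s)%:R * fock Phi s).

(* cond_expect_pred k is E_{k-1}, with E_{-1} = expect *)
Definition cond_expect_pred k :
    generalized_functional Z -> generalized_functional Z :=
  if k is j.+1 then cond_expect j else expect.

End operators.

(* Main.v *)
(* Every estimate is made on chaos coefficients. Continuity of Phi at 0 bounds it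
   by a single seminorm, |Phi xi|^2 <= M |xi|_p^2, and testing on finite chaos
   combinations turns this into the dual bound
   sum_s lambda_s^(-2p) |Phi(Z_s)|^2 <= M. Conversely, every F satisfying such a
   bound is the Fock transform of xi |-> sum_s <Z_s, xi> F(s), so all the
   operators are well defined. The k-th term of the series has the Fock transform
   of Phi restricted to { s | max s = k }, hence the remainder after n terms lives
   on the sets reaching n, where lambda_s >= n + 1; trading this weight against the
   seminorm of index p + 1 makes the remainder O(1/n) uniformly on bounded sets. *)
Require Import Defs.
From mathcomp Require Import all_boot all_order all_algebra.
From mathcomp Require Import finmap complex ring lra.
From mathcomp Require Import all_classical all_reals all_analysis.
Set Implicit Arguments.
Unset Strict Implicit.
Unset Printing Implicit Defensive.
Import Order.TTheory GRing.Theory Num.Theory.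
Import numFieldNormedType.Exports.
Import ComplexField.Normc.
Local Open Scope classical_set_scope.
Local Open Scope ring_scope.

(** * Squared modulus of complex numbers *)

Section modulus.
Context (R : realType).
Local Notation C := (R[i]^o).
Implicit Types (x y z : C).

Lemma normsqE z : normsq z = normc z ^+ 2.
Proof. by case: z => a b; rewrite /normsq /= sqr_sqrtr// addr_ge0 ?sqr_ge0. Qed.

Lemma norm_normc z : `|z| = (normc z)%:C%C.
Proof. by case: z. Qed.

Lemma normc_ge0 z : 0 <= normc z.
Proof. by case: z => a b; exact: sqrtr_ge0. Qed.

Lemma normsqM x y : normsq (x * y) = normsq x * normsq y.
Proof. by rewrite !normsqE normcM exprMn. Qed.

Lemma normsqR (a : R) : normsq (a%:C%C : C) = a ^+ 2.
Proof. by rewrite /normsq /= expr0n addr0. Qed.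

Lemma normsq0 : normsq (0 : C) = 0.
Proof. by rewrite normsqE normc0 expr0n. Qed.

Lemma normsq_conj z : normsq (z^*%C : C) = normsq z.
Proof. by case: z => a b; rewrite /normsq /= sqrrN. Qed.

Lemma mul_conjC z : z * (z^*%C : C) = (normsq z)%:C%C.
Proof.
by case: z => a b; rewrite /normsq; apply/eqP; rewrite eq_complex /=;
  apply/andP; split; apply/eqP; ring.
Qed.

(** The gap is [t] times the squared modulus of [x - t^-1 * y]. The free [t] lets the factor of
    [normsq x] come arbitrarily close to 1, so that this can stand in for the triangle
    inequality. *)
Lemma normsq_add_le (t : R) x y : 0 < t ->
  normsq (x + y) <= (1 + t) * normsq x + (1 + t^-1) * normsq y.
Proof.
move=> t0; have tE : t * t^-1 = 1 by rewrite mulfV// gt_eqF.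
case: x y => [a b] [c e]; rewrite /normsq /= -subr_ge0.
rewrite (_ : _ - _ = t * ((a - t^-1 * c) ^+ 2 + (b - t^-1 * e) ^+ 2)).
  by rewrite mulr_ge0 ?(ltW t0)// addr_ge0 ?sqr_ge0.
by field; rewrite gt_eqF.
Qed.

Lemma normc_sum_le (I : Type) (r : seq I) (F : I -> C) :
  normc (\sum_(i <- r) F i) <= \sum_(i <- r) normc (F i).
Proof.
elim/big_ind2 : _ => [|a b c e ab ce|//]; first by rewrite normc0.
by rewrite (le_trans (le_normcD _ _))// lerD.
Qed.

End modulus.

(** * The weights of finite sets and their powers *)

Section weights.
Context (R : realType).
Implicit Types (s : {fset nat}) (p : R).

Definition pweight p s : R := weight R s `^ (2 * p).

Lemma weight_ge1 s : 1 <= weight R s.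
Proof.
rewrite /weight; elim/big_ind: _ => // [x y x1 y1|k _]; last by rewrite ler1n.
by rewrite -[leLHS]mulr1 ler_pM.
Qed.

Lemma weight_gt0 s : 0 < weight R s.
Proof. exact: lt_le_trans (weight_ge1 s). Qed.

Lemma weightU1 k s : k \notin s -> weight R (k |` s)%fset = k.+1%:R * weight R s.
Proof. by move=> ks; rewrite /weight big_fsetU1. Qed.

Lemma weight_geS k s : k \in s -> k.+1%:R <= weight R s.
Proof.
move=> ks; rewrite -(fsetD1K ks) weightU1 ?fsetD11//.
by rewrite ler_peMr ?weight_ge1// ler0n.
Qed.

Lemma pweight_gt0 p s : 0 < pweight p s.
Proof. by rewrite /pweight powR_gt0// weight_gt0. Qed.

Lemma pweight_ge0 p s : 0 <= pweight p s.
Proof. exact/ltW/pweight_gt0. Qed.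

Lemma pweightU1 p k s : k \notin s ->
  pweight p (k |` s)%fset = k.+1%:R `^ (2 * p) * pweight p s.
Proof. by move=> ks; rewrite /pweight weightU1// powRM// ltW// weight_gt0. Qed.

Lemma pweight_mono p q s : p <= q -> pweight p s <= pweight q s.
Proof. by move=> pq; rewrite /pweight ler_powR ?weight_ge1// ler_pM2l. Qed.

Lemma pweightS p s : pweight (p + 1) s = pweight p s * weight R s ^+ 2.
Proof.
rewrite /pweight mulrDr mulr1 powRD; last by rewrite (gt_eqF (weight_gt0 s)) implybT.
by rewrite -(powR_mulrn 2)// ltW// weight_gt0.
Qed.

End weights.

(** * Squared norms and the topology of S(Z) *)

Section seminorms.
Context d (T : measurableType d) (R : realType) (P : probability T R).
Context (Z : normal_noise P).
Local Notation C := (R[i]^o).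
Local Notation test := (test_functional Z).
Implicit Types (s : {fset nat}) (p : R) (xi eta : test) (A : {fset {fset nat}}).

Definition fcoef xi s : C := inner P (zprod Z s) xi.

(** Squares keep roots out of the estimates; [fine] loses nothing for [0 <= p], where the sum is
    finite. *)
Definition sqnorm p xi : R := fine (snorm2 P Z p xi).

Lemma test_in_S xi : in_S P Z xi.
Proof. exact: set_mem (test_valP xi). Qed.

Lemma fcoef_lin (a : C) xi eta s : fcoef (a *: xi + eta) s = a * fcoef xi s + fcoef eta s.
Proof.
have [L _] := test_in_S xi (lexx 0); have [L' _] := test_in_S eta (lexx 0).
exact: inner_lin.
Qed.

Lemma fcoef0 s : fcoef 0 s = 0.
Proof. by have := fcoef_lin (- 1) 0 0 s; rewrite scaler0 addr0 mulN1r addNr. Qed.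

Lemma fcoefZ a xi s : fcoef (a *: xi) s = a * fcoef xi s.
Proof. by rewrite -[a *: xi]addr0 fcoef_lin fcoef0 addr0. Qed.

Lemma fcoefD xi eta s : fcoef (xi + eta) s = fcoef xi s + fcoef eta s.
Proof. by rewrite -[xi]scale1r fcoef_lin mul1r scale1r. Qed.

Lemma fcoefB xi eta s : fcoef (xi - eta) s = fcoef xi s - fcoef eta s.
Proof. by rewrite fcoefD -scaleN1r fcoefZ mulN1r. Qed.

Lemma fcoef_sum (I : Type) (r : seq I) (F : I -> test) s :
  fcoef (\sum_(i <- r) F i) s = \sum_(i <- r) fcoef (F i) s.
Proof.
by apply: (big_morph (fcoef^~ s)) => [x y|]; rewrite ?fcoefD ?fcoef0.
Qed.

Lemma fcoef_zprod s t : fcoef (test_zprod Z t) s = (s == t)%:R.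
Proof. exact: inner_zprod. Qed.

Lemma snorm2_fin p xi : 0 <= p -> snorm2 P Z p xi = (sqnorm p xi)%:E.
Proof.
move=> p0; rewrite /sqnorm fineK// ge0_fin_numE.
  by have [] := test_in_S xi p0.
by apply: esum_ge0 => s _; rewrite lee_fin mulr_ge0 ?powR_ge0 ?normsq_ge0.
Qed.

Lemma sqnorm_ge_sum p xi A : 0 <= p ->
  \sum_(s <- A) pweight p s * normsq (fcoef xi s) <= sqnorm p xi.
Proof.
move=> p0; rewrite -lee_fin -snorm2_fin//; apply: esum_ge; exists [set` A] => //.
by rewrite fsbig_finite//= set_fsetK sumEFin.
Qed.

Lemma sqnorm_le p xi (K : R) : 0 <= p ->
  (forall A, \sum_(s <- A) pweight p s * normsq (fcoef xi s) <= K) ->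
  sqnorm p xi <= K.
Proof.
move=> p0 AK; rewrite -lee_fin -snorm2_fin//; apply: ge_ereal_sup => _ [X [fX _] <-].
by rewrite fsbig_finite//= sumEFin lee_fin.
Qed.

Lemma sqnorm_approx p xi (e : R) : 0 <= p -> 0 < e -> exists A,
  sqnorm p xi - e < \sum_(s <- A) pweight p s * normsq (fcoef xi s).
Proof.
move=> p0 e0; apply: contrapT => /forallNP H.
have /sqnorm_le : forall A, \sum_(s <- A) pweight p s * normsq (fcoef xi s) <=
    sqnorm p xi - e by move=> A; rewrite leNgt; apply/negP; exact: H.
by move=> /(_ p0); rewrite leNgt ltrBlDr ltrDl e0.
Qed.

Lemma sqnorm_ge0 p xi : 0 <= p -> 0 <= sqnorm p xi.
Proof. by move=> p0; have := sqnorm_ge_sum xi fset0 p0; rewrite big_nil. Qed.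

Lemma sqnorm_mono p q xi : 0 <= p -> p <= q -> sqnorm p xi <= sqnorm q xi.
Proof.
move=> p0 pq; apply: sqnorm_le => // A.
rewrite (le_trans _ (sqnorm_ge_sum xi A (le_trans p0 pq)))//.
by apply: ler_sum => s _; rewrite ler_wpM2r ?normsq_ge0// pweight_mono.
Qed.

Lemma sqnormZ_le p (a : C) xi : 0 <= p -> sqnorm p (a *: xi) <= normsq a * sqnorm p xi.
Proof.
move=> p0; apply: sqnorm_le => // A.
rewrite (eq_bigr (fun s => normsq a * (pweight p s * normsq (fcoef xi s)))).
  by rewrite -mulr_sumr ler_wpM2l ?normsq_ge0// sqnorm_ge_sum.
by move=> s _; rewrite fcoefZ normsqM; ring.
Qed.

Lemma sqnorm_add_le p (t : R) xi eta : 0 <= p -> 0 < t ->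
  sqnorm p (xi + eta) <= (1 + t) * sqnorm p xi + (1 + t^-1) * sqnorm p eta.
Proof.
move=> p0 t0; apply: sqnorm_le => // A.
apply: (@le_trans _ _ (\sum_(s <- A) ((1 + t) * (pweight p s * normsq (fcoef xi s)) +
   (1 + t^-1) * (pweight p s * normsq (fcoef eta s))))).
  apply: ler_sum => s _; rewrite fcoefD.
  have := ler_wpM2l (pweight_ge0 p s) (normsq_add_le (fcoef xi s) (fcoef eta s) t0).
  by move=> /le_trans; apply; rewrite le_eqVlt; apply/orP; left; apply/eqP; ring.
rewrite big_split /= -!mulr_sumr lerD// ler_wpM2l ?sqnorm_ge_sum// addr_ge0//.
  exact: ltW.
by rewrite invr_ge0 ltW.
Qed.

Lemma sqnorm0 p : 0 <= p -> sqnorm p 0 = 0.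
Proof.
move=> p0; apply/eqP; rewrite eq_le sqnorm_ge0// andbT sqnorm_le// => A.
by rewrite big1// => s _; rewrite fcoef0 normsq0 mulr0.
Qed.

Lemma snorm_lt p xi (e : R) : 0 <= p -> 0 < e -> (snorm p xi < e) = (sqnorm p xi < e ^+ 2).
Proof.
move=> p0 e0; rewrite /snorm -/(sqnorm p xi) -{1}(ger0_norm (ltW e0)) -sqrtr_sqr.
by rewrite ltr_sqrt// exprn_gt0.
Qed.

Lemma snorm_ballE p xi (e : R) eta : 0 <= p -> 0 < e ->
  snorm_ball p xi e eta = (sqnorm p (eta - xi) < e ^+ 2).
Proof. by move=> p0 e0; rewrite -snorm_lt. Qed.

Lemma snorm_ball0E p (e : R) xi : 0 <= p -> 0 < e ->
  snorm_ball p 0 e xi = (sqnorm p xi < e ^+ 2).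
Proof. by move=> p0 e0; rewrite snorm_ballE// subr0. Qed.

(** Subbasic balls may have any centre, while the estimates at 0 need balls about 0. *)
Lemma snorm_ball_sub0 p xi (e : R) : 0 <= p -> 0 < e -> snorm_ball p xi e 0 ->
  exists2 e', 0 < e' & snorm_ball p 0 e' `<=` snorm_ball p xi e.
Proof.
move=> p0 e0; rewrite snorm_ballE// sub0r.
set q := sqnorm p (- xi) => qe.
have q0 : 0 <= q by exact: sqnorm_ge0.
(* Then [t * q <= (e ^+ 2 - q) / 2], so [(1 + t) * q] stays below [e ^+ 2]; the [+ 1] covers
   [q = 0]. The squared radius chosen below is the room left, divided by [1 + t^-1]. *)
pose t := (e ^+ 2 - q) / (2 * (q + 1)).
have t0 : 0 < t by rewrite divr_gt0// ?subr_gt0// mulr_gt0// ltr_wpDl.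
have tq : (1 + t) * q < e ^+ 2.
  have : t * (2 * (q + 1)) = e ^+ 2 - q.
    by rewrite /t divfK// mulf_neq0// gt_eqF// ltr_wpDl.
  have : 0 <= t * q by rewrite mulr_ge0// ltW.
  by lra.
have t1 : 0 < 1 + t^-1 by rewrite ltr_pwDl// ltW// invr_gt0.
have e'0 : 0 < (e ^+ 2 - (1 + t) * q) / (1 + t^-1).
  by rewrite divr_gt0// subr_gt0.
exists (Num.sqrt ((e ^+ 2 - (1 + t) * q) / (1 + t^-1))); first by rewrite sqrtr_gt0.
move=> x; rewrite snorm_ball0E ?sqrtr_gt0// sqr_sqrtr ?(ltW e'0)// ltr_pdivlMr//.
rewrite snorm_ballE// [x - _]addrC => xt.
apply: le_lt_trans (sqnorm_add_le (- xi) x p0 t0) _.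
by rewrite -/q; lra.
Qed.

Lemma snorm_ball_nbhs p xi (e : R) : 0 <= p -> 0 < e -> nbhs xi (snorm_ball p xi e).
Proof.
move=> p0 e0; exists (snorm_ball p xi e); split => //; last first.
  by rewrite /snorm_ball /= subrr snorm_lt// sqnorm0// exprn_gt0.
(* An open set is a union of finite intersections of subbasic balls; here both the union and the
   intersection have a single member. *)
exists [set snorm_ball p xi e].
  move=> _ ->; exists [fset snorm_ball p xi e]%fset.
    by move=> B /fset1P ->; apply/mem_set; exists p, xi, e.
  by apply/seteqP; split => x /=; [apply; exact: fset11|move=> bx B /fset1P ->].
by rewrite bigcup_set1.
Qed.

(* Finitely many subbasic balls contain a single one, since the norms increase with p. *)
Lemma nbhs0_snorm_ball (V : set test) : nbhs (0 : test) V ->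
  exists p e, [/\ 0 <= p, 0 < e & snorm_ball p 0 e `<=` V].
Proof.
move=> [B [[D sD <-] [U' DU' U'0] sV]].
pose U : set test := U'; have DU : D U := DU'; have U0 : U 0 := U'0.
have [F sF FE] : finI_from [set B | exists p (xi : test) e,
  [/\ 0 <= p, 0 < e & B = snorm_ball p xi e]] id U := sD _ DU.
suff [p [e [p0 e0 s]]] : exists p e, [/\ 0 <= p, 0 < e &
    forall G : set test, G \in enum_fset F -> snorm_ball p 0 e `<=` G].
  exists p, e; split => // x bx; apply: sV; exists U => //.
  by suff : U x by []; rewrite -FE => G GF; exact: s bx.
have F0 G : G \in F -> G 0 by move=> GF; move: U0; rewrite -FE => /(_ _ GF).
have one (G : set test) : G \in F -> exists p e, [/\ 0 <= p, 0 < e &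
    snorm_ball p 0 e `<=` G].
  move=> GF; have G0 := F0 _ GF.
  have := sF _ GF; rewrite inE => -[p [xi [e [p0 e0 GE]]]].
  rewrite {}GE in G0 *.
  by have [e' e'0 h] := snorm_ball_sub0 p0 e0 G0; exists p, e'.
(* Restated over the enumerating list, on which the induction runs once the link to [F] is
   dropped. *)
have {one} : forall G : set test, G \in enum_fset F -> exists p e, [/\ 0 <= p, 0 < e &
    snorm_ball p 0 e `<=` G] by [].
move: (enum_fset F) => r {F sF FE F0}.
elim: r => [|G r ih] one.
  by exists 0, 1; split.
have [p [e [p0 e0 s]]] := one _ (mem_head _ _).
have [|q [e' [q0 e'0 s']]] := ih; first by move=> H Hr; apply: one; rewrite inE Hr orbT.
exists (Num.max p q), (Num.min e e').
have pq0 : 0 <= Num.max p q by rewrite le_max p0.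
have ee0 : 0 < Num.min e e' by rewrite lt_min e0.
split => // H; rewrite inE => /orP[/eqP ->|Hr] x; rewrite snorm_ball0E// => xe.
  apply: s; rewrite snorm_ball0E//.
  apply: le_lt_trans (sqnorm_mono _ p0 _) _; last apply: (lt_le_trans xe).
    by rewrite le_max lexx.
  by rewrite !expr2 ler_pM ?(ltW ee0)// ge_min lexx.
apply: (s' _ Hr); rewrite snorm_ball0E//.
apply: le_lt_trans (sqnorm_mono _ q0 _) _; last apply: (lt_le_trans xe).
  by rewrite le_max lexx orbT.
by rewrite !expr2 ler_pM ?(ltW ee0)// ge_min lexx orbT.
Qed.

End seminorms.

(** * Sums over finite sets *)

Section finite_sums.
Context (K : choiceType).
Implicit Types (A B : {fset K}) (r : seq K).

Lemma sum_fset_uniq (V : nmodType) r (f : K -> V) : uniq r ->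
  \sum_(x <- r) f x = \sum_(x <- [fset x in r]%fset) f x.
Proof.
move=> ur; apply: perm_big; apply: uniq_perm; rewrite ?fset_uniq//.
by move=> x; rewrite inE.
Qed.

Lemma sum_fset_le (R : realDomainType) A B (g : K -> R) : (forall x, 0 <= g x) ->
  \sum_(x <- B | x \in A) g x <= \sum_(x <- A) g x.
Proof.
move=> g0; rewrite -big_filter (@perm_big _ _ _ _ _ [seq x <- A | x \in B]).
  rewrite big_filter big_mkcond; apply: ler_sum => x _.
  by case: ifP.
apply: uniq_perm; rewrite ?filter_uniq ?fset_uniq// => x.
by rewrite !mem_filter andbC.
Qed.

Lemma sum_fsetU (V : nmodType) A B (g : K -> V) :
  \sum_(x <- (A `|` B)%fset) g x = \sum_(x <- A) g x + \sum_(x <- B | x \notin A) g x.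
Proof.
rewrite -[X in _ + X]big_filter -big_cat; apply: perm_big.
apply: uniq_perm => [||x].
- exact: fset_uniq.
- rewrite cat_uniq fset_uniq filter_uniq ?fset_uniq// andbT; apply/hasPn => x.
  by rewrite mem_filter => /andP[].
- by rewrite mem_cat mem_filter in_fsetU; case: (x \in A).
Qed.

Lemma sum_fset_delta (S : pzSemiRingType) A (f : K -> S) t :
  \sum_(s <- A) f s * (t == s)%:R = (t \in A)%:R * f t.
Proof.
have [tA|tA] := boolP (t \in A); last first.
  rewrite mul0r big_seq big1// => s sA; case: eqP sA => [<-|_ _]; last by rewrite mulr0.
  by rewrite (negbTE tA).
rewrite (big_fsetD1 t)//= eqxx mulr1 mul1r big_seq big1 ?addr0// => s.
by rewrite in_fsetD1 eq_sym => /andP[/negbTE ->]; rewrite mulr0.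
Qed.

End finite_sums.

(** * Seminorm bounds and finite chaos combinations *)

Section functionals.
Context d (T : measurableType d) (R : realType) (P : probability T R).
Context (Z : normal_noise P).
Local Notation C := (R[i]^o).
Local Notation test := (test_functional Z).
Implicit Types (s t : {fset nat}) (p : R) (xi eta : test) (A B : {fset {fset nat}}).
Implicit Types (Phi Psi : generalized_functional Z) (F : {fset nat} -> C).

Lemma gen_lin Phi (a : C) xi eta : Phi (a *: xi + eta) = a * Phi xi + Phi eta.
Proof. by have [+ _] := set_mem (generalized_valP Phi); exact. Qed.

Lemma gen_continuous Phi : continuous (Phi : test -> C).
Proof. by have [] := set_mem (generalized_valP Phi). Qed.

Lemma gen0 Phi : Phi 0 = 0.
Proof. by have := gen_lin Phi (- 1) 0 0; rewrite scaler0 addr0 mulN1r addNr. Qed.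

Lemma genZ Phi a xi : Phi (a *: xi) = a * Phi xi.
Proof. by rewrite -[a *: xi]addr0 gen_lin gen0 addr0. Qed.

Lemma genD Phi xi eta : Phi (xi + eta) = Phi xi + Phi eta.
Proof. by rewrite -[xi]scale1r gen_lin mul1r scale1r. Qed.

Lemma gen_sum Phi (I : Type) (r : seq I) (f : I -> test) :
  Phi (\sum_(i <- r) f i) = \sum_(i <- r) Phi (f i).
Proof. by apply: (big_morph Phi) => [x y|]; rewrite ?genD ?gen0. Qed.

(** By continuity some ball of radius [e] about 0 is mapped into the unit disc; homogeneity turns
    this into a bound with [M = e ^- 2]. *)
Lemma gen_bounded Phi : exists p M, [/\ 0 <= p, 0 <= M &
  forall xi, normsq (Phi xi) <= M * sqnorm p xi].
Proof.
have FF := nbhs_filter (0 : test).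
have /cvgrPdist_lt/(_ 1 ltr01) := @gen_continuous Phi 0.
move=> /nbhs0_snorm_ball[p [e [p0 e0 h]]].
exists p, (e ^- 2); split => //; first by rewrite invr_ge0 exprn_ge0// ltW.
move=> xi; apply/ler_addgt0Pr => r r0.
(* The slack [r] keeps the divisor [q] positive when [sqnorm p xi] vanishes, and puts the multiple
   of [xi] by [a] strictly inside the ball. *)
have q0 : 0 < sqnorm p xi + r * e ^+ 2.
  by rewrite ltr_wpDl// ?sqnorm_ge0// mulr_gt0// exprn_gt0.
set q := sqnorm p xi + _ in q0.
pose a : R := e / Num.sqrt q.
have a2 : a ^+ 2 = e ^+ 2 / q by rewrite /a expr_div_n sqr_sqrtr// ltW.
have : snorm_ball p 0 e ((a%:C%C : C) *: xi).
  rewrite snorm_ball0E//; apply: le_lt_trans (sqnormZ_le _ _ p0) _.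
  rewrite normsqR a2 mulrAC ltr_pdivrMr// ltr_pM2l ?exprn_gt0//.
  by rewrite /q ltrDl mulr_gt0// exprn_gt0.
move=> /h /=; rewrite gen0 sub0r normrN genZ norm_normc ltcE => /andP[_ l1].
have : normsq ((a%:C%C : C) * Phi xi) < 1.
  by rewrite normsqE expr_lt1// normc_ge0.
have e2 : 0 < e ^+ 2 by rewrite exprn_gt0.
rewrite normsqM normsqR a2 mulrAC ltr_pdivrMr// mul1r => /ltW l2.
rewrite -(ler_pM2l e2); suff -> : e ^+ 2 * (e ^- 2 * sqnorm p xi + r) = q by [].
by rewrite /q; field; rewrite gt_eqF.
Qed.

Definition comb A F : test := \sum_(s <- A) F s *: test_zprod Z s.

Lemma fcoef_comb A F s : fcoef (comb A F) s = (s \in A)%:R * F s.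
Proof.
rewrite fcoef_sum -sum_fset_delta; apply: eq_bigr => t _.
by rewrite fcoefZ fcoef_zprod.
Qed.

Lemma gen_comb Phi A F : Phi (comb A F) = \sum_(s <- A) F s * fock Phi s.
Proof. by rewrite gen_sum; apply: eq_bigr => s _; rewrite genZ. Qed.

Lemma sqnorm_comb_le p A F : 0 <= p ->
  sqnorm p (comb A F) <= \sum_(s <- A) pweight p s * normsq (F s).
Proof.
move=> p0; apply: sqnorm_le => // B.
apply: le_trans (sum_fset_le A B _); last first.
  by move=> s; rewrite mulr_ge0 ?pweight_ge0 ?normsq_ge0.
rewrite [leRHS]big_mkcond /=; apply: ler_sum => s _; rewrite fcoef_comb.
by case: (s \in A); rewrite ?mul1r// mul0r normsq0 mulr0.
Qed.

(** The difference has no coefficients in [A], so its partial sum over [B], added to that of [xi]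
    over [A], is at most the partial sum of [xi] over the union. *)
Lemma sqnorm_tail_le p xi A : 0 <= p ->
  sqnorm p (xi - comb A (fcoef xi)) <=
  sqnorm p xi - \sum_(s <- A) pweight p s * normsq (fcoef xi s).
Proof.
move=> p0; apply: sqnorm_le => // B; rewrite lerBrDl.
apply: le_trans (sqnorm_ge_sum xi (A `|` B)%fset p0); rewrite sum_fsetU lerD2l.
rewrite [leRHS]big_mkcond /=; apply: ler_sum => s _; rewrite fcoefB fcoef_comb.
by case: (s \in A); rewrite ?mul1r ?subrr ?normsq0 ?mulr0// mul0r subr0.
Qed.

(* Testing Phi on the conjugates of its own coefficients, damped by the weight,
   turns the seminorm bound into the dual weighted l2 bound. *)
Lemma fock_l2 Phi p M : 0 <= p -> 0 <= M ->
  (forall xi, normsq (Phi xi) <= M * sqnorm p xi) ->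
  forall A, \sum_(s <- A) (pweight p s)^-1 * normsq (fock Phi s) <= M.
Proof.
move=> p0 M0 h A; set S := \sum_(s <- A) _.
pose F s : C := ((pweight p s)^-1)%:C%C * (fock Phi s)^*%C.
have S0 : 0 <= S.
  by apply: sumr_ge0 => s _; rewrite mulr_ge0 ?normsq_ge0// invr_ge0 pweight_ge0.
have PE : Phi (comb A F) = (S%:C%C : C).
  rewrite gen_comb /S rmorph_sum /=; apply: eq_bigr => s _.
  by rewrite /F -mulrA [_^*%C * _]mulrC mul_conjC rmorphM.
have QE : sqnorm p (comb A F) <= S.
  apply: le_trans (sqnorm_comb_le A F p0) _; apply: ler_sum => s _.
  rewrite /F normsqM normsqR normsq_conj expr2 !mulrA mulfV ?mul1r//.
  by rewrite gt_eqF// pweight_gt0.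
have := h (comb A F); rewrite PE normsqR => SS.
(* By [SS] and [QE], [S ^+ 2 <= M * S], where [S] can be cancelled unless it is 0. *)
have [->//|Sn0] := eqVneq S 0.
have S1 : 0 < S by rewrite lt_neqAle eq_sym Sn0.
rewrite -(ler_pM2r S1) -expr2 (le_trans SS)//.
exact: ler_wpM2l.
Qed.

(** Finite combinations approximate [xi] in the seminorm that controls [Phi], so finite coefficient
    sums decide the bound and no series has to be summed. *)
Lemma gen_le Phi xi (K : R) :
  (forall A, \sum_(s <- A) normc (fcoef xi s) * normc (fock Phi s) <= K) ->
  normc (Phi xi) <= K.
Proof.
move=> h; have [p [M [p0 M0 hM]]] := gen_bounded Phi.
apply/ler_addgt0Pr => e e0.
have M1 : 0 < M + 1 by rewrite ltr_wpDl.
(* This tolerance makes the value of [Phi] on the tail at most [e] in modulus; [M + 1] replaces [M],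
   which may be 0. *)
have [A hA] := @sqnorm_approx _ _ _ _ Z p xi (e ^+ 2 / (M + 1)) p0
  (divr_gt0 (exprn_gt0 2 e0) M1).
have -> : xi = comb A (fcoef xi) + (xi - comb A (fcoef xi)) by rewrite addrC subrK.
rewrite genD (le_trans (le_normcD _ _))// lerD//.
  rewrite gen_comb (le_trans (normc_sum_le _ _))//.
  by rewrite (le_trans _ (h A))//; apply: ler_sum => s _; rewrite normcM.
rewrite -(ler_pXn2r (ltn0Sn 1)) ?nnegrE ?normc_ge0 ?(ltW e0)// -normsqE.
apply: le_trans (hM _) _.
apply: (@le_trans _ _ ((M + 1) * (e ^+ 2 / (M + 1)))); last first.
  by rewrite mulrC divfK// gt_eqF.
apply: ler_pM => //; [exact: sqnorm_ge0|by rewrite lerDl|].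
by apply: le_trans (sqnorm_tail_le _ _ p0) _; lra.
Qed.

End functionals.

(** * Absolutely convergent real series and a weighted AM-GM inequality *)

Lemma cvg_series_le (R : realType) (u : nat -> R) (K : R) :
  (forall N, \sum_(0 <= n < N) `|u n| <= K) ->
  cvgn (series u) /\ `|limn (series u)| <= K.
Proof.
move=> h; have cu : cvgn [normed series u].
  apply: nondecreasing_is_cvgn; first by apply: nondecreasing_series => n _ _; exact: normr_ge0.
  by exists K => _ [N _ <-]; exact: h.
split; first exact: normed_cvg.
apply: le_trans (lim_series_norm cu) _; apply: limr_le => //.
by near=> N; exact: h.
Unshelve. all: by end_near. Qed.

(** The gap is [w * (x - w^-1 * y) ^+ 2 / 2]. With [w] a weight, this splits the pairing of
    coefficients into a weighted sum and a dual weighted sum. *)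
Lemma amgm_weighted (R : realFieldType) (w x y : R) : 0 < w ->
  x * y <= (w * x ^+ 2 + w^-1 * y ^+ 2) / 2.
Proof.
move=> w0; rewrite -subr_ge0 (_ : _ - _ = w * (x - w^-1 * y) ^+ 2 / 2).
  by rewrite divr_ge0// mulr_ge0 ?sqr_ge0// ltW.
by field; rewrite gt_eqF.
Qed.

(** * Existence of a functional with a given Fock transform *)

Section existence.
Context d (T : measurableType d) (R : realType) (P : probability T R).
Context (Z : normal_noise P).
Local Notation C := (R[i]^o).
Local Notation test := (test_functional Z).
Context (F : {fset nat} -> C) (p M : R) (p0 : 0 <= p).
Context (FM : forall A : {fset {fset nat}},
  \sum_(s <- A) (pweight p s)^-1 * normsq (F s) <= M).
Implicit Types (xi eta : test) (A : {fset {fset nat}}).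

Lemma sum_fcoef_le xi A :
  \sum_(s <- A) normc (fcoef xi s) * normc (F s) <= (sqnorm p xi + M) / 2.
Proof.
apply: (@le_trans _ _ (\sum_(s <- A) (pweight p s * normsq (fcoef xi s) / 2 +
   (pweight p s)^-1 * normsq (F s) / 2))).
  apply: ler_sum => s _; rewrite -mulrDl !normsqE.
  exact/amgm_weighted/pweight_gt0.
by rewrite big_split /= -!mulr_suml -mulrDl ler_pM2r// lerD// sqnorm_ge_sum.
Qed.

(** Runs through the finite sets by their codes; a number that is no code contributes 0.
    [pickle_inv] decodes only the exact code of a set, so no set is counted twice. *)
Let term xi n : C := oapp (fun s => fcoef xi s * F s) 0 (pickle_inv n).

Let term_lin (a : C) xi eta n : term (a *: xi + eta) n = a * term xi n + term eta n.
Proof.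
rewrite /term; case: (pickle_inv n) => [s|] /=; last by rewrite mulr0 addr0.
by rewrite fcoef_lin mulrDl mulrA.
Qed.

Let sum_term_le xi N : \sum_(0 <= n < N) normc (term xi n) <= (sqnorm p xi + M) / 2.
Proof.
apply: le_trans (sum_fcoef_le xi [fset s in pmap pickle_inv (index_iota 0 N)]%fset).
rewrite -sum_fset_uniq; last first.
  by apply: (pmap_uniq (@pickle_invK _)); exact: iota_uniq.
rewrite big_pmap le_eqVlt; apply/orP; left; apply/eqP; apply: eq_bigr => n _.
by rewrite /term; case: (pickle_inv n) => [s|]; [exact: normcM|exact: normc0].
Qed.

Let Re_le (z : C) : `|complex.Re z| <= normc z.
Proof. by have := normc_ge_Re z; rewrite norm_normc lecR. Qed.

Let Im_le (z : C) : `|complex.Im z| <= normc z.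
Proof.
rewrite -(ler_pXn2r (ltn0Sn 1)) ?nnegrE ?normc_ge0// -normsqE.
by rewrite real_normK ?num_real// /normsq lerDr sqr_ge0.
Qed.

Let cvgRe xi : cvgn (series (fun n => complex.Re (term xi n))) /\
  `|limn (series (fun n => complex.Re (term xi n)))| <= (sqnorm p xi + M) / 2.
Proof.
apply: cvg_series_le => N; apply: le_trans (sum_term_le xi N).
by apply: ler_sum => n _; exact: Re_le.
Qed.

Let cvgIm xi : cvgn (series (fun n => complex.Im (term xi n))) /\
  `|limn (series (fun n => complex.Im (term xi n)))| <= (sqnorm p xi + M) / 2.
Proof.
apply: cvg_series_le => N; apply: le_trans (sum_term_le xi N).
by apply: ler_sum => n _; exact: Im_le.
Qed.

(** Real and imaginary parts are summed as two real series, each dominated by the moduli of the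
    terms. *)
Let total xi : C := Complex (limn (series (fun n => complex.Re (term xi n))))
  (limn (series (fun n => complex.Im (term xi n)))).

Let lim_lin3 (a b : R) (u v w : nat -> R) : cvgn (series u) -> cvgn (series v) ->
  cvgn (series w) ->
  limn (series (fun n => a * u n + b * v n + w n)) =
  a * limn (series u) + b * limn (series v) + limn (series w).
Proof.
move=> cu cv cw.
have cau : cvgn (series (a *: u)) by exact: is_cvg_seriesZ.
have cbv : cvgn (series (b *: v)) by exact: is_cvg_seriesZ.
rewrite -[a * _]/(a *: _) -lim_seriesZ// -[b * _]/(b *: _) -lim_seriesZ//.
rewrite -lim_seriesD// -lim_seriesD//.
exact: is_cvg_seriesD.
Qed.

Let total_lin (a : C) xi eta : total (a *: xi + eta) = a * total xi + total eta.
Proof.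
have [[cr _] [ci _]] := (cvgRe xi, cvgIm xi).
have [[cr' _] [ci' _]] := (cvgRe eta, cvgIm eta).
rewrite /total; case: a => a b.
rewrite [RHS](_ : _ = Complex
  (a * limn (series (fun n => complex.Re (term xi n))) +
   - b * limn (series (fun n => complex.Im (term xi n))) +
   limn (series (fun n => complex.Re (term eta n))))
  (a * limn (series (fun n => complex.Im (term xi n))) +
   b * limn (series (fun n => complex.Re (term xi n))) +
   limn (series (fun n => complex.Im (term eta n))))); last by rewrite mulNr.
rewrite -!lim_lin3//; congr Complex; congr (limn (series _)); apply/funext => n;
  rewrite term_lin; case: (term xi n) (term eta n) => [x y] [u v] //=.
by rewrite mulNr.
Qed.

Let total_bound xi : sqnorm p xi <= 1 -> normsq (total xi) <= (1 + M) ^+ 2.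
Proof.
move=> x1; have [_ r] := cvgRe xi; have [_ i] := cvgIm xi.
rewrite /normsq /=; move: r i; set r := limn _; set i := limn _ => hr hi.
have h z : `|z| <= (sqnorm p xi + M) / 2 -> z ^+ 2 <= ((1 + M) / 2) ^+ 2.
  move=> hz; rewrite -real_normK ?num_real// -subr_ge0 subr_sqr mulr_ge0//.
    by rewrite subr_ge0 (le_trans hz)// ler_pM2r// lerD2r.
  by rewrite addr_ge0// (le_trans (normr_ge0 z))// (le_trans hz)// ler_pM2r// lerD2r.
have := h _ hr; have := h _ hi; have := sqr_ge0 (1 + M); lra.
Qed.

(** A linear map bounded on the unit ball is continuous: [y - x] is rescaled into that ball by
    [dl^-1]. *)
Let total_continuous : continuous (total : test -> C).
Proof.
move=> x; have FF := nbhs_filter x; apply/cvgrPdist_lt => e e0.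
(* A positive element of [R[i]] is real. *)
have [er e'0] : e = (complex.Re e)%:C%C /\ 0 < complex.Re e.
  by move: e0; rewrite ltcE => /andP[/eqP /= i0 r0]; split => //; case: e i0 r0 => a b /= ->.
set r := complex.Re e in er e'0.
have M0 : 0 <= M by have := FM fset0; rewrite big_nil.
have M1 : 0 < 2 + M by rewrite ltr_wpDr.
(* [2 + M] exceeds the bound [1 + M] from [total_bound], which makes the final inequality strict. *)
have [dl d0 rE] : exists2 dl, 0 < dl & r = dl * (2 + M).
  by exists (r / (2 + M)); rewrite ?divr_gt0// divfK// gt_eqF.
apply: filterS (snorm_ball_nbhs x p0 d0) => y; rewrite snorm_ballE// => xy.
rewrite -normrN opprB norm_normc er ltcR.
have -> : total y - total x = total (y - x).
  have := total_lin (- 1) x y; rewrite scaleN1r mulN1r addrC => ->.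
  by rewrite addrC.
have dn0 : dl != 0 by rewrite gt_eqF.
have yE : y - x = (dl%:C%C : C) *: (((dl^-1)%:C%C : C) *: (y - x)).
  by rewrite scalerA -rmorphM mulfV//= scale1r.
rewrite yE -[X in total X]addr0 total_lin.
have -> : total 0 = 0.
  by have := total_lin (- 1) 0 0; rewrite scaler0 addr0 mulN1r addNr.
have l : normsq (total (((dl^-1)%:C%C : C) *: (y - x))) <= (1 + M) ^+ 2.
  apply: total_bound; apply: le_trans (sqnormZ_le _ _ p0) _.
  rewrite normsqR exprVn -ler_pdivlMl ?invr_gt0 ?exprn_gt0// invrK mulr1.
  exact: ltW.
rewrite addr0 -(ltr_pXn2r (ltn0Sn 1)) ?nnegrE ?normc_ge0 ?(ltW e'0)//.
rewrite -normsqE normsqM normsqR rE exprMn ltr_pM2l ?exprn_gt0//.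
by apply: le_lt_trans l _; rewrite ltr_pXn2r ?nnegrE ?addr_ge0// ltrD2r ltr1n.
Qed.

Lemma fock_exists : exists Phi : generalized_functional Z, forall s, fock Phi s = F s.
Proof.
have LC : (total : test -> C) \in @generalized_pred _ _ _ _ Z.
  apply/mem_set; split; last exact: total_continuous.
  by move=> a x y; exact: total_lin.
exists (GeneralizedFunctional LC) => t; rewrite /fock /= /total.
(* Only the index coding [t] contributes, so the partial sums are eventually constant. *)
have termE n : term (test_zprod Z t) n = (n == choice.pickle t)%:R * F t.
  rewrite /term; have := @pickle_invK {fset nat} n.
  case E : (pickle_inv n) => [s|] /=.
    rewrite fcoef_zprod => <-; rewrite (inj_eq (pcan_inj choice.pickleK)).
    by have [->|] := eqVneq s t; rewrite ?mul0r.
  by move=> _; case: eqP => [nt|]; rewrite ?mul0r//; rewrite nt pickleK_inv in E.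
have lim1 (f : C -> R) : f 0 = 0 ->
    limn (series (fun n => f (term (test_zprod Z t) n))) = f (F t).
  move=> f0; apply/cvg_lim => //; apply: cvg_near_cst.
  exists (choice.pickle t).+1 => // N /= tN; rewrite /series /= (bigD1_seq (choice.pickle t))//=.
  - rewrite termE eqxx mul1r big1 ?addr0// => n /negbTE nt.
    by rewrite termE nt mul0r.
  - by rewrite mem_index_iota.
  - exact: iota_uniq.
by rewrite !lim1//; case: (F t).
Qed.

End existence.

(** * Fock transforms of the operators, the series and its remainder *)

Section fock_transforms.
Context d (T : measurableType d) (R : realType) (P : probability T R).
Context (Z : normal_noise P).
Local Notation C := (R[i]^o).
Local Notation test := (test_functional Z).
Implicit Types (s t : {fset nat}) (p : R) (xi eta : test) (A B : {fset {fset nat}}).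
Implicit Types (Phi Psi : generalized_functional Z) (F : {fset nat} -> C).

Lemma fockD Phi Psi s : fock (Phi + Psi) s = fock Phi s + fock Psi s.
Proof. by []. Qed.

Lemma fockB Phi Psi s : fock (Phi - Psi) s = fock Phi s - fock Psi s.
Proof. by []. Qed.

Lemma fock0 s : fock (0 : generalized_functional Z) s = 0.
Proof. by []. Qed.

(** [F] lives on [D], where it is dominated by the transform of [Phi] along [h]. Injectivity of [h]
    and the weight ratio [c] carry the dual bound of [Phi] over to [F] with constant [c * M], so a
    functional with transform [F] exists and [of_fock] selects it. *)
Lemma fock_of_fock Phi F (D : pred {fset nat}) (h : {fset nat} -> {fset nat}) :
  {in D &, injective h} ->
  (forall s, D s -> normsq (F s) <= normsq (fock Phi (h s))) ->
  (forall s, ~~ D s -> F s = 0) ->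
  (forall p, 0 <= p -> exists2 c : R, 0 <= c &
    forall s, D s -> (pweight p s)^-1 <= c * (pweight p (h s))^-1) ->
  forall s, fock (of_fock Z F) s = F s.
Proof.
move=> hinj FD F0 hp.
apply: (@xgetPex _ (0 : generalized_functional Z) [set Psi | forall s, fock Psi s = F s]).
have [p [M [p0 M0 hM]]] := gen_bounded Phi.
have [c c0 hc] := hp p p0.
apply: (@fock_exists _ _ _ _ Z F p (c * M) p0) => A.
have h0 s : 0 <= (pweight p s)^-1 * normsq (fock Phi s).
  by rewrite mulr_ge0 ?normsq_ge0// invr_ge0 pweight_ge0.
apply: (@le_trans _ _ (\sum_(s <- [seq h s | s <- A & D s])
    c * ((pweight p s)^-1 * normsq (fock Phi s)))).
  rewrite big_map big_filter [leRHS]big_mkcond /=; apply: ler_sum => s _.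
  case: ifPn => [Ds|nDs]; last by rewrite F0// normsq0 mulr0.
  by rewrite mulrA ler_pM ?FD ?hc ?normsq_ge0// invr_ge0 pweight_ge0.
rewrite -mulr_sumr ler_wpM2l// sum_fset_uniq; first exact: fock_l2 p0 M0 hM _.
rewrite map_inj_in_uniq ?filter_uniq ?fset_uniq// => s t.
by rewrite !mem_filter => /andP[Ds _] /andP[Dt _]; exact: hinj.
Qed.

Lemma fock_annihilation k Phi s :
  fock (annihilation k Phi) s = (k \notin s)%:R * fock Phi (k |` s)%fset.
Proof.
have -> : (k \notin s)%:R = 1 - (k \in s)%:R :> C.
  by case: (k \in s); rewrite ?subrr ?subr0.
apply: (@fock_of_fock Phi _ [pred s | k \notin s] (fun s => k |` s)%fset).
- by move=> u v /= ku kv e; rewrite -(fsetU1K ku) e fsetU1K.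
- by move=> u /= /negbTE ->; rewrite subr0 mul1r.
- by move=> u /=; rewrite negbK => ->; rewrite subrr mul0r.
(* Adding [k] multiplies [pweight p] by exactly this factor. *)
- move=> p p0; exists (k.+1%:R `^ (2 * p)); first exact: powR_ge0.
  move=> u /= ku; rewrite pweightU1// invfM mulrA mulfV ?mul1r//.
Qed.

Lemma fock_creation k Phi s :
  fock (creation k Phi) s = (k \in s)%:R * fock Phi (s `\ k)%fset.
Proof.
apply: (@fock_of_fock Phi _ [pred s | k \in s] (fun s => s `\ k)%fset).
- by move=> u v /= ku kv e; rewrite -(fsetD1K ku) e fsetD1K.
- by move=> u /= ->; rewrite mul1r.
- by move=> u /= /negbTE ->; rewrite mul0r.
(* Removing [k] does not raise the weight, so the factor 1 suffices. *)
- move=> p p0; exists 1 => // u /= ku; rewrite mul1r lef_pV2 ?posrE ?pweight_gt0//.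
  rewrite -[in leRHS](fsetD1K ku) pweightU1 ?fsetD11// ler_peMl ?pweight_ge0//.
  by rewrite -[leLHS](powRr0 k.+1%:R) ler_powR ?ler1n// mulr_ge0.
Qed.

Lemma fock_restrict Phi F (D : pred {fset nat}) :
  (forall s, F s = (D s)%:R * fock Phi s) -> forall s, fock (of_fock Z F) s = F s.
Proof.
move=> FE; apply: (@fock_of_fock Phi _ D id).
- by move=> u v.
- by move=> u Du; rewrite FE Du mul1r.
- by move=> u /negbTE Du; rewrite FE Du mul0r.
- by move=> p p0; exists 1 => // u _; rewrite mul1r.
Qed.

Lemma fock_expect Phi s : fock (expect Phi) s = (s == fset0)%:R * fock Phi s.
Proof.
have E u : fock Phi fset0 * inner P (cst 1) (zprod Z u) =
    (u == fset0)%:R * fock Phi u.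
  (* The constant 1 is the empty product; orthonormality then leaves only [u = fset0]. *)
  have -> : (cst 1 : T -> C) = zprod Z fset0.
    by apply/funext => w; rewrite /zprod /rprod big_nil.
  rewrite inner_zprod eq_sym; have [->|] := eqVneq u fset0; first by rewrite mulrC.
  by rewrite mulr0 mul0r.
by rewrite -E; exact: (@fock_restrict Phi _ [pred s | s == fset0]).
Qed.

Lemma fock_cond_expect k Phi s :
  fock (cond_expect k Phi) s = (all (fun j => (j <= k)%N) s)%:R * fock Phi s.
Proof. exact: (@fock_restrict Phi _ (fun s => all (fun j => (j <= k)%N) s)). Qed.

(** The strict inequality absorbs both the index shift and the case [k = 0], where only the empty
    set passes. *)
Lemma fock_cond_expect_pred k Phi s :
  fock (cond_expect_pred k Phi) s = (all (fun j => (j < k)%N) s)%:R * fock Phi s.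
Proof.
case: k => [|k] /=; last exact: fock_cond_expect.
rewrite fock_expect; congr (_%:R * _); congr nat_of_bool.
have [->//|/fset0Pn[j js]] := eqVneq s fset0.
by symmetry; apply/negbTE/allPn; exists j.
Qed.

Definition clark_term Phi k : generalized_functional Z :=
  creation k (cond_expect_pred k (annihilation k Phi)).

(** [creation] takes [k] out of [s] and [annihilation] puts it back, so only indicators remain: [k]
    lies in [s] and the rest of [s] lies strictly below [k]. *)
Lemma fock_clark_term k Phi s : fock (clark_term Phi k) s =
  ((k \in s) && all (fun j => (j <= k)%N) s)%:R * fock Phi s.
Proof.
rewrite fock_creation; have [ks|ks] /= := boolP (k \in s); last by rewrite !mul0r.
rewrite mul1r fock_cond_expect_pred fock_annihilation fsetD11 mul1r fsetD1K//.
congr (_%:R * _); congr nat_of_bool; apply/allP/allP => h j js.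
  have [->//|jk] := eqVneq j k.
  by apply/ltnW/h; rewrite in_fsetD1 jk.
by move: js; rewrite in_fsetD1 => /andP[jk js]; rewrite ltn_neqAle jk h.
Qed.

(** A nonempty set below [n.+1] either has maximum [n] or is a nonempty set below [n]; the induction
    adds up this partition. *)
Lemma fock_series_clark Phi n s : fock (series (clark_term Phi) n) s =
  ((s != fset0) && all (fun j => (j < n)%N) s)%:R * fock Phi s.
Proof.
elim: n => [|n ih].
  rewrite /series /= big_geq// fock0; have [->|] := eqVneq s fset0; first by rewrite mul0r.
  move=> /fset0Pn[j js] /=.
  by have -> : all (fun j => (j < 0)%N) s = false; [apply/negbTE/allPn; exists j|rewrite mul0r].
rewrite seriesSr fockD ih fock_clark_term -mulrDl; congr (_ * _).
have [ns|ns] /= := boolP (n \in s).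
  have -> : all (fun j => (j < n)%N) s = false.
    by apply/negbTE/allPn; exists n => //; rewrite ltnn.
  have -> : s != fset0 by apply/fset0Pn; exists n.
  by rewrite add0r.
rewrite addr0; congr (_ && _)%:R; apply/allP/allP => h j js.
  by rewrite ltnS ltnW// h.
rewrite ltn_neqAle -ltnS h// andbT; apply: contraNneq ns => <-.
exact: js.
Qed.

(** The expectation accounts for the empty set and the partial sum for the nonempty sets below
    [n]. *)
Lemma fock_remainder Phi n s :
  fock (Phi - expect Phi - series (clark_term Phi) n) s =
  (~~ all (fun j => (j < n)%N) s)%:R * fock Phi s.
Proof.
rewrite !fockB fock_expect fock_series_clark.
rewrite -[X in X - _ - _]mul1r -!mulrBl; congr (_ * _).
have [->|s0] /= := eqVneq s fset0; first by rewrite subrr subr0.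
by case: (all _ _); rewrite /= ?subr0 ?subrr.
Qed.

(* A set reaching n has weight at least n + 1, so passing from p to p + 1 gains
   a factor (n + 1)^2; AM-GM splits the gain evenly over the two factors. *)
Lemma remainder_le Phi : exists p M, 0 <= p /\ forall n xi,
  normc ((Phi - expect Phi - series (clark_term Phi) n) xi) <=
  (sqnorm p xi + M) / n.+1%:R.
Proof.
have [p [M [p0 M0 hM]]] := gen_bounded Phi.
have p10 : 0 <= p + 1 by rewrite addr_ge0.
exists (p + 1), M; split=> // n xi; apply: gen_le => A.
have n0 : 0 < n.+1%:R :> R by rewrite ltr0n.
apply: (@le_trans _ _ (\sum_(s <- A)
  ((pweight (p + 1) s * normsq (fcoef xi s) + (pweight p s)^-1 * normsq (fock Phi s))
   / n.+1%:R))).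
  apply: ler_sum => s _; rewrite fock_remainder.
  have W := pweight_gt0 p s; have W1 := pweight_gt0 (p + 1) s.
  have [an|an] /= := boolP (all _ _).
    rewrite mul0r normc0 mulr0 divr_ge0// addr_ge0// mulr_ge0 ?normsq_ge0 ?ltW//.
    by rewrite invr_gt0.
  rewrite mul1r ler_pdivlMr// mulrC.
  have nw : n.+1%:R <= weight R s.
    have [j js] := allPn an; rewrite -leqNgt => nj.
    by apply: le_trans (weight_geS R js); rewrite ler_nat ltnS.
  (* With the weight [pweight p s * n.+1%:R], multiplying by [n.+1%:R] frees the dual part of [n]
     and puts [n.+1%:R ^+ 2] on the coefficient part, where [pweight (p + 1) s] absorbs it. *)
  have := amgm_weighted (normc (fcoef xi s)) (normc (fock Phi s))
    (mulr_gt0 W n0).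
  rewrite -!normsqE => amgm.
  have nw2 : n.+1%:R ^+ 2 <= weight R s ^+ 2 by rewrite !expr2 ler_pM// ltW.
  apply: (@le_trans _ _ ((n.+1%:R ^+ 2 * pweight p s * normsq (fcoef xi s) +
     (pweight p s)^-1 * normsq (fock Phi s)) / 2)).
    apply: le_trans (ler_wpM2l (ltW n0) amgm) _.
    rewrite le_eqVlt; apply/orP; left; apply/eqP; field.
    by rewrite !gt_eqF.
  have h1 : n.+1%:R ^+ 2 * pweight p s * normsq (fcoef xi s) <=
      pweight (p + 1) s * normsq (fcoef xi s).
    by rewrite ler_wpM2r ?normsq_ge0// pweightS mulrC ler_pM2l.
  have h2 : 0 <= pweight (p + 1) s * normsq (fcoef xi s).
    by rewrite mulr_ge0 ?normsq_ge0// ltW.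
  have h3 : 0 <= (pweight p s)^-1 * normsq (fock Phi s).
    by rewrite mulr_ge0 ?normsq_ge0// invr_ge0 ltW.
  by lra.
rewrite -mulr_suml ler_pM2r ?invr_gt0// big_split lerD ?sqnorm_ge_sum//.
exact: fock_l2 p0 M0 hM _.
Qed.

End fock_transforms.

(** * Bounded sets and convergence in the strong topology *)

Section strong_topology.
Context d (T : measurableType d) (R : realType) (P : probability T R).
Context (Z : normal_noise P).
Local Notation C := (R[i]^o).
Local Notation test := (test_functional Z).
Local Notation gen := (generalized_functional Z).
Implicit Types (p : R) (xi : test) (B : set test) (Phi : gen).

(** The unit ball of index [p] absorbs [B]; taking the scalar [r] itself gives [K = r ^+ 2]. *)
Lemma bounded_sqnorm B p : von_neumann_bounded B -> 0 <= p ->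
  exists K, forall xi, B xi -> sqnorm p xi <= K.
Proof.
move=> bB p0; have [r r0 h] := bB _ (snorm_ball_nbhs (0 : test) p0 ltr01).
have rr : (r%:C%C <= `|(r%:C%C : R[i])|).
  by rewrite norm_normc /= expr0n addr0 sqrtr_sqr lecR ler_norm.
exists (r ^+ 2) => xi /(h _ rr)[eta]; rewrite snorm_ball0E// expr1n => eta1 <-.
apply: le_trans (sqnormZ_le _ _ p0) _; rewrite normsqR.
by rewrite -[leRHS]mulr1 ler_wpM2l ?sqr_ge0// ltW.
Qed.

(** This is what makes strong convergence imply pointwise convergence. *)
Lemma bounded_set1 xi : von_neumann_bounded [set xi].
Proof.
move=> V /nbhs0_snorm_ball[p [e [p0 e0 h]]].
have q0 : 0 < sqnorm p xi + 1 by rewrite ltr_wpDl ?sqnorm_ge0.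
(* Since [1 <= r], the squared modulus of [t] is at least [r] too, and [r * e ^+ 2] exceeds
   [sqnorm p xi]. *)
pose r : R := (sqnorm p xi + 1) / e ^+ 2 + 1.
have r1 : 1 <= r by rewrite lerDr divr_ge0 ?exprn_ge0 ?ltW.
have r0 : 0 < r by exact: lt_le_trans r1.
exists r => // t; rewrite norm_normc lecR => rt _ ->.
have t0 : 0 < normc t by exact: lt_le_trans rt.
have tn0 : t != 0 by apply: contraTneq t0 => ->; rewrite normc0 ltxx.
exists (t^-1 *: xi); last by rewrite scalerA mulfV// scale1r.
apply: h; rewrite snorm_ball0E//; apply: le_lt_trans (sqnormZ_le _ _ p0) _.
rewrite normsqE normcV exprVn ltr_pdivrMl ?exprn_gt0//.
have rE : sqnorm p xi + 1 = (r - 1) * e ^+ 2.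
  by rewrite /r addrK divfK// gt_eqF ?exprn_gt0.
have r2 : r <= normc t ^+ 2.
  by rewrite expr2 -[leLHS]mulr1 ler_pM// ?(le_trans r1)// ltW.
have : r * e ^+ 2 <= normc t ^+ 2 * e ^+ 2 by rewrite ler_pM2r ?exprn_gt0.
have : 0 < e ^+ 2 by rewrite exprn_gt0.
by lra.
Qed.

Lemma cvg_strong (u : nat -> gen) (L : gen) :
  (forall B, von_neumann_bounded B -> forall e : R, 0 < e ->
    \forall n \near \oo, forall xi, B xi -> normc ((L - u n) xi) < e) ->
  u @ \oo --> L.
Proof.
(* A neighbourhood in the initial topology contains the preimage of an open set [V] of the function
   space, so it is enough to converge there. *)
move=> h W [V' [[V oV <-] VL sW]].
have : (fun n => generalized_val (u n)) @ \oo -->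
    (generalized_val L : {family @von_neumann_bounded _ _ _ _ Z, test -> C}).
  apply/fam_cvgP => B bB Q /uniform_nbhs[E [entE sQ]].
  move: entE; rewrite -entourage_ballE => -[e /= e0 sE].
  have [er e'0] : e = (complex.Re e)%:C%C /\ 0 < complex.Re e.
    by move: e0; rewrite ltcE => /andP[/eqP /= i0 r0]; split => //; case: e i0 r0 {sE} => a b /= ->.
  apply: filterS (h B bB _ e'0) => n hn; apply: sQ => xi Bxi; apply: sE.
  suff : `|(L - u n) xi| < e by [].
  by rewrite er norm_normc ltcR; exact: hn.
move=> /(_ V (open_nbhs_nbhs (conj oV VL))) uV.
suff : \forall n \near \oo, W (u n) by [].
have {}uV : \forall n \near \oo, V (generalized_val (u n)) by [].
by apply: filterS uV => n; exact: sW.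
Qed.

Lemma strong_cvg_eval (u : nat -> gen) (L : gen) xi :
  u @ \oo --> L -> (fun n => u n xi) @ \oo --> L xi.
Proof.
move=> uL.
have : (fun n => generalized_val (u n)) @ \oo -->
    (generalized_val L : {family @von_neumann_bounded _ _ _ _ Z, test -> C}).
  move=> V /(@initial_continuous _ _ (fun Phi : gen => (generalized_val Phi :
     {family @von_neumann_bounded _ _ _ _ Z, test -> C})) L) cV.
  exact: (uL _ cV).
move=> /fam_cvgP/(_ _ (bounded_set1 xi)) h.
by rewrite uniform_set1 in h.
Qed.

(** [limn] is a chosen limit, so its value is known only once limits are unique. Point evaluations
    separate functionals and take values in a Hausdorff space. *)
Lemma strong_cvg_unique (u : nat -> gen) (L L' : gen) :
  u @ \oo --> L -> u @ \oo --> L' -> L = L'.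
Proof.
move=> uL uL'; apply: val_inj; apply/funext => xi.
exact: (cvg_unique (@norm_hausdorff _ C) (@strong_cvg_eval u L xi uL)
  (@strong_cvg_eval u L' xi uL')).
Qed.

(** If [K] bounds [sqnorm p] on a bounded set, the remainder there is at most [(K + M) / n.+1%:R],
    uniformly. *)
Lemma cvg_series_clark Phi : series (clark_term Phi) @ \oo --> Phi - expect Phi.
Proof.
have [p [M [p0 hM]]] := remainder_le Phi.
apply: cvg_strong => B bB e e0; have [K hK] := bounded_sqnorm bB p0.
near=> n => xi Bxi; apply: le_lt_trans (hM n xi) _.
rewrite ltr_pdivrMr ?ltr0n//; apply: (@le_lt_trans _ _ (K + M)).
  by rewrite lerD2r hK.
rewrite mulrC -ltr_pdivrMr//; apply: (@lt_trans _ _ n%:R); last by rewrite ltr_nat.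
by near: n; exact: nbhs_infty_gtr.
Unshelve. all: by end_near. Qed.

End strong_topology.

(** * The Clark-Ocone type representation *)

Theorem theorem3p14 (d : measure_display) (T : measurableType d) (R : realType)
    (P : probability T R) (Z : normal_noise P)
    (hZ : chaotic_representation P Z) (Phi : generalized_functional Z) :
  let u : nat -> generalized_functional Z :=
    fun k => creation k (cond_expect_pred k (annihilation k Phi)) in
  cvgn (series u) /\ Phi = expect Phi + limn (series u).
Proof.
move=> u; have uL : series u @ \oo --> Phi - expect Phi by exact: cvg_series_clark.
have cu : cvgn (series u) by apply/cvg_ex; exists (Phi - expect Phi).
(* [cu] says that the partial sums converge to [limn (series u)], which uniqueness identifies with
   [Phi - expect Phi]. *)
split=> //; rewrite -(strong_cvg_unique uL cu).
by rewrite addrC subrK.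
Qed.
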